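(* The $2$-category $\mathbf{Tor}_{\mathrm R}$ of rectangular torsion theories is $2$-equivalent, over $\mathbf{PointCat}$, to the $2$-category $\mathbf{Ps}\text{-}M^\ast\text{-}\mathbf{Alg}$ of pseudo-algebras (and pseudo-morphisms between them) of the (strict) $2$-monad $$M^\ast\colon \mathbf{PointCat}\to\mathbf{PointCat},\qquad \mathbb C\mapsto \mathbb C\times\mathbb C,\quad G\mapsto G\times G,\quad \alpha\mapsto\alpha\times\alpha .$$
   Context: **Pretorsion theories.** A pretorsion theory is a triple $(\mathbb C,\mathcal T,\mathcal F)$ with $\mathbb C$ a category and $\mathcal T,\mathcal F$ full replete (closed under isomorphism) subcategories such that, putting $\mathcal Z=\mathcal T\cap\mathcal F$ and calling a morphism null if it factors through an object of $\mathcal Z$: (T1) every morphism from an object of $\mathcal T$ to an object of $\mathcal F$ is null; (T2) for every object $X$ there is a short exact sequence $T^X\xrightarrow{\ell^X}X\xrightarrow{r^X}F^X$ with $T^X\in\mathcal T$, $F^X\in\mathcal F$. Here a kernel of $f\colon X\to Y$ is a morphism $k\colon K\to X$ with $fk$ null such that every $u$ with $fu$ null factors uniquely through $k$; cokernels are dual; a sequence $(\ell,r)$ is short exact if $\ell$ is a kernel of $r$ and $r$ is a cokernel of $\ell$. Objects of $\mathcal T$ are called torsion, objects of $\mathcal F$ torsion-free. Pretorsion theories are assumed equipped with a choice of such a short exact sequence for each $X$, with $\ell^T=\mathrm{id}_T$ for $T\in\mathcal T$ and $r^F=\mathrm{id}_F$ for $F\in\mathcal F$. Each $h\colon X\to Y$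 induces unique $h^T\colon T^X\to T^Y$, $h^F\colon F^X\to F^Y$ commuting with the $\ell$'s and $r$'s. **Rectangularity.** $(\mathbb C,\mathcal T,\mathcal F)$ is rectangular if the canonical functor $\Gamma\colon\mathbb C\to\mathcal T\times\mathcal F$, $X\mapsto(T^X,F^X)$, $h\mapsto(h^T,h^F)$, is an equivalence of categories. A rectangular torsion theory is a rectangular pretorsion theory with $\mathbb C$ pointed (having a zero object) and $\mathcal T\cap\mathcal F$ equal to the full subcategory $\mathbf 0$ of zero objects of $\mathbb C$. **2-categories.** $\mathbf{Tor}_{\mathrm R}$ has as objects rectangular torsion theories; its $1$-cells $(\mathbb C,\mathcal T,\mathcal F)\to(\mathbb C',\mathcal T',\mathcal F')$ are functors $\mathbb C\to\mathbb C'$ preserving torsion and torsion-free objects and sending chosen short exact sequences to (not necessarily chosen) short exact sequences; its $2$-cells are natural transformations. $\mathbf{PointCat}$ is the $2$-category of pointed categories, zero-object-preserving functors and natural transformations. The forgetful $2$-functor $\mathbf{Tor}_{\mathrm R}\to\mathbf{PointCat}$ is $(\mathbb C,\mathcal T,\mathcal F)\mapsto\mathbb C$; pseudo-algebras have the usual forgetful $2$-functor to $\mathbf{PointCat}$; ''over $\mathbf{PointCat}$'' means compatibly with these forgetful $2$-functors. **The 2-monad.** The unit of $M^\ast$ at $\mathbb C$ is the diagonal $\mathbb C\to\mathbb C\times\mathbb C$, and the multiplication at $\mathbb C$ is the projection $\pi_{1,4}\colon(\mathbb C\times\mathbb C)\times(\mathbb C\times\mathbb C)\to\mathbb C\times\mathbb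 C$ on the first and fourth components. Pseudo-algebras, pseudo-morphisms and their $2$-cells (which are the $2$-cells of $\mathbf{Ps}\text{-}M^\ast\text{-}\mathbf{Alg}$) are the standard notions for a $2$-monad. *)

(* Defs.v *)
From Stdlib Require Import ClassicalEpsilon FunctionalExtensionality ProofIrrelevance.

Set Implicit Arguments.
Unset Strict Implicit.
Unset Printing Implicit Defensive.

Declare Scope cat_scope.
Local Open Scope cat_scope.

Record Category := {
  Ob :> Type;
  Hom : Ob -> Ob -> Type;
  idm : forall A, Hom A A;
  comp : forall A B C, Hom B C -> Hom A B -> Hom A C;
  comp_assoc : forall A B C D (h : Hom C D) (g : Hom B C) (f : Hom A B),
    comp (comp h g) f = comp h (comp g f);
  comp_idl : forall A B (f : Hom A B), comp (idm B) f = f;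
  comp_idr : forall A B (f : Hom A B), comp f (idm A) = f }.

Arguments Hom {c} _ _.
Arguments idm {c} A.
Notation "g ∘ f" := (comp g f) (at level 40, left associativity) : cat_scope.

Definition is_iso (C : Category) (A B : C) (f : Hom A B) : Prop :=
  exists g : Hom B A, g ∘ f = idm A /\ f ∘ g = idm B.

Definition isomorphic (C : Category) (A B : C) : Prop :=
  exists f : Hom A B, is_iso f.

(** [heq f g]: the arrows [f] and [g] are equal, their (propositionally, but
    maybe not definitionally) equal sources and targets being identified. *)
Inductive heq (C : Category) (A B : C) (f : Hom A B) :
    forall A' B' : C, Hom A' B' -> Prop :=
  heq_refl : heq f f.

(** The identity arrow, seen as an arrow between propositionally equal objects. *)
Definition eqmor (C : Category) (A B : C) (e : A = B) : Hom A B :=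
  match e with eq_refl => idm A end.

Definition paste (C : Category) (A B B' D : C) (e : B = B')
    (g : Hom B' D) (f : Hom A B) : Hom A D := g ∘ (eqmor e ∘ f).
Notation "g ∘[ e ] f" := (paste e g f)
  (at level 40, left associativity, format "g  ∘[ e ]  f") : cat_scope.

Lemma heq_eq (C : Category) (A B : C) (f g : Hom A B) : heq f g -> f = g.
Proof.
intros H.
assert (K : exists (eA : A = A) (eB : B = B),
  eq_rect B (Hom A) (eq_rect A (fun X => Hom X B) f A eA) B eB = g).
{ destruct H. now exists eq_refl, eq_refl. }
destruct K as [eA [eB <-]].
now rewrite (proof_irrelevance _ eA eq_refl), (proof_irrelevance _ eB eq_refl).
Qed.

Lemma heq_of_eq (C : Category) (A B : C) (f g : Hom A B) : f = g -> heq f g.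
Proof. intros ->; constructor. Qed.

Lemma heq_sym (C : Category) (A B A' B' : C) (f : Hom A B) (f' : Hom A' B') :
  heq f f' -> heq f' f.
Proof. intros []; constructor. Qed.

Lemma heq_trans (C : Category) (A B A' B' A'' B'' : C) (f : Hom A B)
  (f' : Hom A' B') (f'' : Hom A'' B'') : heq f f' -> heq f' f'' -> heq f f''.
Proof. intros [] H; exact H. Qed.

Lemma heq_src (C : Category) (A B A' B' : C) (f : Hom A B) (f' : Hom A' B') :
  heq f f' -> A = A'.
Proof. now intros []. Qed.

Lemma heq_tgt (C : Category) (A B A' B' : C) (f : Hom A B) (f' : Hom A' B') :
  heq f f' -> B = B'.
Proof. now intros []. Qed.

Lemma heq_eqmor (C : Category) (A B : C) (e : A = B) : heq (eqmor e) (idm A).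
Proof. destruct e; constructor. Qed.

Lemma heq_comp (C : Category) (A B D A' B' D' : C) (g : Hom B D) (f : Hom A B)
  (g' : Hom B' D') (f' : Hom A' B') :
  heq g g' -> heq f f' -> heq (g ∘ f) (g' ∘ f').
Proof.
intros Hg Hf; revert f f' Hf; destruct Hg; intros f f' Hf.
pose proof (heq_src Hf) as e; destruct e.
rewrite (heq_eq Hf); constructor.
Qed.

Lemma heq_comp_eqmorl (C : Category) (A B B' : C) (e : B = B') (f : Hom A B) :
  heq (eqmor e ∘ f) f.
Proof. destruct e; simpl; rewrite comp_idl; constructor. Qed.

Lemma heq_comp_eqmorr (C : Category) (A A' B : C) (e : A' = A) (f : Hom A B) :
  heq (f ∘ eqmor e) f.
Proof. destruct e; simpl; rewrite comp_idr; constructor. Qed.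

Lemma paste_assoc (C : Category) (A B B' D D' E : C) (e : B = B') (e1 : D = D')
  (h : Hom D' E) (g : Hom B' D) (f : Hom A B) :
  h ∘[e1] g ∘[e] f = h ∘[e1] (g ∘[e] f).
Proof. unfold paste; now rewrite !comp_assoc. Qed.

Lemma is_iso_idm (C : Category) (A : C) : is_iso (idm A).
Proof. exists (idm A); now rewrite comp_idl. Qed.

Lemma is_iso_eqmor (C : Category) (A B : C) (e : A = B) : is_iso (eqmor e).
Proof. destruct e; apply is_iso_idm. Qed.

Lemma is_iso_comp (C : Category) (A B D : C) (g : Hom B D) (f : Hom A B) :
  is_iso g -> is_iso f -> is_iso (g ∘ f).
Proof.
intros [g' [g1 g2]] [f' [f1 f2]]; exists (f' ∘ g'); split.
- now rewrite comp_assoc, <- (comp_assoc g'), g1, comp_idl.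
- now rewrite comp_assoc, <- (comp_assoc f), f2, comp_idl.
Qed.

Lemma is_iso_paste (C : Category) (A B B' D : C) (e : B = B') (g : Hom B' D)
  (f : Hom A B) : is_iso g -> is_iso f -> is_iso (g ∘[e] f).
Proof. intros; apply is_iso_comp; trivial; apply is_iso_comp; trivial; apply is_iso_eqmor. Qed.

(** Pairs with definitional eta. *)
#[projections(primitive)]
Record pair (A B : Type) := Pair { pr1 : A; pr2 : B }.
Notation "⟨ x , y ⟩" := (Pair x y) (format "⟨ x ,  y ⟩") : cat_scope.

Definition ProdCat (C D : Category) : Category.
Proof.
refine {| Ob := pair C D;
  Hom := fun X Y => pair (Hom (pr1 X) (pr1 Y)) (Hom (pr2 X) (pr2 Y));
  idm := fun X => ⟨idm (pr1 X), idm (pr2 X)⟩;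
  comp := fun X Y Z g f => ⟨pr1 g ∘ pr1 f, pr2 g ∘ pr2 f⟩ |}.
- abstract (intros; simpl; now rewrite !comp_assoc).
- abstract (intros; simpl; now rewrite !comp_idl).
- abstract (intros; simpl; now rewrite !comp_idr).
Defined.

Record Functor (C D : Category) := {
  fob :> C -> D;
  fmap : forall A B, Hom A B -> Hom (fob A) (fob B);
  fmap_id : forall A, fmap (idm A) = idm (fob A);
  fmap_comp : forall A B E (g : Hom B E) (f : Hom A B),
    fmap (g ∘ f) = fmap g ∘ fmap f }.

Arguments fmap {C D} _ {A B} _.

Definition IdF (C : Category) : Functor C C.
Proof. refine {| fob := fun X => X; fmap := fun X Y f => f |}; abstract reflexivity. Defined.

Definition CompF (C D E : Category) (G : Functor D E) (F : Functor C D) : Functor C E.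
Proof.
refine {| fob := fun X => G (F X); fmap := fun X Y f => fmap G (fmap F f) |}.
- abstract (intros; now rewrite !fmap_id).
- abstract (intros; now rewrite !fmap_comp).
Defined.

Lemma functor_ext (C D : Category) (F G : Functor C D) :
  (forall X Y (f : Hom X Y), heq (fmap F f) (fmap G f)) -> F = G.
Proof.
intros H.
assert (E : fob F = fob G).
{ apply functional_extensionality; intros X; exact (heq_src (H X X (idm X))). }
destruct F as [F0 F1 F2 F3], G as [G0 G1 G2 G3]; simpl in *; subst G0.
assert (E : F1 = G1).
{ apply functional_extensionality_dep; intros X.
  apply functional_extensionality_dep; intros Y.
  apply functional_extensionality_dep; intros f. apply heq_eq, H. }
subst G1; f_equal; apply proof_irrelevance.
Qed.

Lemma heq_fmap (C D : Category) (F : Functor C D) (A B A' B' : C) (f : Hom A B)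
  (f' : Hom A' B') : heq f f' -> heq (fmap F f) (fmap F f').
Proof. intros []; constructor. Qed.

Lemma is_iso_fmap (C D : Category) (F : Functor C D) (A B : C) (f : Hom A B) :
  is_iso f -> is_iso (fmap F f).
Proof.
intros [g [H K]]; exists (fmap F g); now rewrite <- !fmap_comp, H, K, !fmap_id.
Qed.

Record NatTrans (C D : Category) (F G : Functor C D) := {
  nt_app :> forall X, Hom (F X) (G X);
  nt_nat : forall X Y (f : Hom X Y), nt_app Y ∘ fmap F f = fmap G f ∘ nt_app X }.

Lemma nt_ext (C D : Category) (F G : Functor C D) (α β : NatTrans F G) :
  (forall X, α X = β X) -> α = β.
Proof.
destruct α as [a p], β as [b q]; simpl; intros H.
assert (a = b) by now apply functional_extensionality_dep.
subst b; f_equal; apply proof_irrelevance.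
Qed.

Definition nt_id (C D : Category) (F : Functor C D) : NatTrans F F.
Proof.
refine {| nt_app := fun X => idm (F X) |}.
abstract (intros; now rewrite comp_idl, comp_idr).
Defined.

Definition nt_comp (C D : Category) (F G H : Functor C D)
  (β : NatTrans G H) (α : NatTrans F G) : NatTrans F H.
Proof.
refine {| nt_app := fun X => β X ∘ α X |}.
abstract (intros; now rewrite comp_assoc, nt_nat, <- comp_assoc, nt_nat, comp_assoc).
Defined.

Definition nt_hcomp (C D E : Category) (F F' : Functor C D) (G G' : Functor D E)
  (β : NatTrans G G') (α : NatTrans F F') : NatTrans (CompF G F) (CompF G' F').
Proof.
refine {| nt_app := fun X => (β (F' X) ∘ fmap G (α X) : Hom (CompF G F X) (CompF G' F' X)) |}.
abstract (intros; simpl; rewrite comp_assoc, <- fmap_comp, (nt_nat α), fmap_comp,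
  <- comp_assoc, (nt_nat β), comp_assoc; reflexivity).
Defined.

Definition FunCat (C D : Category) : Category.
Proof.
refine {| Ob := Functor C D; Hom := @NatTrans C D; idm := @nt_id C D;
  comp := @nt_comp C D |}.
- abstract (intros; apply nt_ext; intros; apply comp_assoc).
- abstract (intros; apply nt_ext; intros; apply comp_idl).
- abstract (intros; apply nt_ext; intros; apply comp_idr).
Defined.

Definition is_equivalence (C D : Category) (F : Functor C D) : Prop :=
  exists G : Functor D C,
    @isomorphic (FunCat C C) (IdF C) (CompF G F) /\
    @isomorphic (FunCat D D) (CompF F G) (IdF D).

Definition FullSub (C : Category) (P : C -> Prop) : Category.
Proof.
refine {| Ob := {X : C | P X};
  Hom := fun X Y => Hom (proj1_sig X) (proj1_sig Y);
  idm := fun X => idm (proj1_sig X); comp := fun X Y Z g f => g ∘ f |}.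
- abstract (intros; apply comp_assoc).
- abstract (intros; apply comp_idl).
- abstract (intros; apply comp_idr).
Defined.

(** Strict 2-categories: [thom A B] is the category of 1-cells and 2-cells from
    [A] to [B]; interchange is the functoriality of [tcomp]. *)
Record TwoCategory := {
  tob :> Type;
  thom : tob -> tob -> Category;
  tid : forall A, thom A A;
  tcomp : forall A B C, Functor (ProdCat (thom B C) (thom A B)) (thom A C);
  tassoc : forall A B C D (h : thom C D) (g : thom B C) (f : thom A B),
    tcomp A B D ⟨tcomp B C D ⟨h, g⟩, f⟩ = tcomp A C D ⟨h, tcomp A B C ⟨g, f⟩⟩;
  tidl : forall A B (f : thom A B), tcomp A B B ⟨tid B, f⟩ = f;
  tidr : forall A B (f : thom A B), tcomp A A B ⟨f, tid A⟩ = f;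
  tassoc2 : forall A B C D (h h' : thom C D) (g g' : thom B C) (f f' : thom A B)
      (γ : Hom h h') (β : Hom g g') (α : Hom f f'),
    heq (fmap (tcomp A B D) (A := ⟨_, _⟩) (B := ⟨_, _⟩)
           ⟨fmap (tcomp B C D) (A := ⟨_, _⟩) (B := ⟨_, _⟩) ⟨γ, β⟩, α⟩)
        (fmap (tcomp A C D) (A := ⟨_, _⟩) (B := ⟨_, _⟩)
           ⟨γ, fmap (tcomp A B C) (A := ⟨_, _⟩) (B := ⟨_, _⟩) ⟨β, α⟩⟩);
  tidl2 : forall A B (f f' : thom A B) (α : Hom f f'),
    heq (fmap (tcomp A B B) (A := ⟨_, _⟩) (B := ⟨_, _⟩) ⟨idm (tid B), α⟩) α;
  tidr2 : forall A B (f f' : thom A B) (α : Hom f f'),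
    heq (fmap (tcomp A A B) (A := ⟨_, _⟩) (B := ⟨_, _⟩) ⟨α, idm (tid A)⟩) α }.

Arguments thom {t} _ _.
Arguments tid {t} A.
Arguments tcomp {t} A B C.

Definition tcomp1 (K : TwoCategory) (A B C : K) (g : thom B C) (f : thom A B) :
  thom A C := tcomp A B C ⟨g, f⟩.
Notation "g · f" := (tcomp1 g f) (at level 39, left associativity) : cat_scope.

Definition tcomp2 (K : TwoCategory) (A B C : K) (g g' : thom B C) (f f' : thom A B)
  (β : Hom g g') (α : Hom f f') : Hom (g · f) (g' · f') :=
  fmap (tcomp A B C) (A := ⟨g, f⟩) (B := ⟨g', f'⟩) ⟨β, α⟩.
Notation "β ⋆ α" := (tcomp2 β α) (at level 39, left associativity) : cat_scope.

Notation "g ◃ α" := (tcomp2 (idm g) α) (at level 39, left associativity) : cat_scope.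
Notation "β ▹ f" := (tcomp2 β (idm f)) (at level 39, left associativity) : cat_scope.

Record TwoFunctor (K L : TwoCategory) := {
  tfob :> K -> L;
  tfhom : forall A B, Functor (@thom K A B) (@thom L (tfob A) (tfob B));
  tf_id : forall A, tfhom A A (tid A) = tid (tfob A);
  tf_comp : forall A B C (g : thom B C) (f : thom A B),
    tfhom A C (g · f) = tfhom B C g · tfhom A B f;
  tf_comp2 : forall A B C (g g' : thom B C) (f f' : thom A B)
      (β : Hom g g') (α : Hom f f'),
    heq (fmap (tfhom A C) (β ⋆ α)) (fmap (tfhom B C) β ⋆ fmap (tfhom A B) α) }.

Definition tf1 (K L : TwoCategory) (T : TwoFunctor K L) (A B : K) (f : thom A B) :
  thom (T A) (T B) := tfhom T A B f.

Definition tf2 (K L : TwoCategory) (T : TwoFunctor K L) (A B : K) (f g : thom A B)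
  (α : Hom f g) : Hom (tf1 T f) (tf1 T g) := fmap (tfhom T A B) α.

Lemma tcomp1A (K : TwoCategory) (A B C D : K) (h : thom C D) (g : thom B C)
  (f : thom A B) : h · g · f = h · (g · f).
Proof. apply tassoc. Qed.

Lemma tcomp1l (K : TwoCategory) (A B : K) (f : thom A B) : tid B · f = f.
Proof. apply tidl. Qed.

Lemma tcomp1r (K : TwoCategory) (A B : K) (f : thom A B) : f · tid A = f.
Proof. apply tidr. Qed.

Lemma tcomp2A (K : TwoCategory) (A B C D : K) (h h' : thom C D) (g g' : thom B C)
  (f f' : thom A B) (γ : Hom h h') (β : Hom g g') (α : Hom f f') :
  heq (γ ⋆ β ⋆ α) (γ ⋆ (β ⋆ α)).
Proof. apply tassoc2. Qed.

Lemma tcomp2l (K : TwoCategory) (A B : K) (f f' : thom A B) (α : Hom f f') :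
  heq (tid B ◃ α) α.
Proof. apply tidl2. Qed.

Lemma tcomp2r (K : TwoCategory) (A B : K) (f f' : thom A B) (α : Hom f f') :
  heq (α ▹ tid A) α.
Proof. apply tidr2. Qed.

Lemma tcomp2_id (K : TwoCategory) (A B C : K) (g : thom B C) (f : thom A B) :
  idm g ⋆ idm f = idm (g · f).
Proof. exact (fmap_id (tcomp A B C) ⟨g, f⟩). Qed.

Lemma tcomp2_comp (K : TwoCategory) (A B C : K) (g g' g'' : thom B C)
  (f f' f'' : thom A B) (β' : Hom g' g'') (β : Hom g g') (α' : Hom f' f'')
  (α : Hom f f') : (β' ∘ β) ⋆ (α' ∘ α) = (β' ⋆ α') ∘ (β ⋆ α).
Proof.
exact (@fmap_comp _ _ (tcomp A B C) ⟨g, f⟩ ⟨g', f'⟩ ⟨g'', f''⟩ ⟨β', α'⟩ ⟨β, α⟩).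
Qed.

Lemma heq_tcomp2 (K : TwoCategory) (A B C : K) (g1 g1' g2 g2' : thom B C)
  (f1 f1' f2 f2' : thom A B) (β1 : Hom g1 g1') (β2 : Hom g2 g2')
  (α1 : Hom f1 f1') (α2 : Hom f2 f2') :
  heq β1 β2 -> heq α1 α2 -> heq (β1 ⋆ α1) (β2 ⋆ α2).
Proof. intros [] []; constructor. Qed.

Lemma heq_tf2 (K L : TwoCategory) (T : TwoFunctor K L) (A B : K)
  (f f' g g' : thom A B) (α : Hom f f') (β : Hom g g') :
  heq α β -> heq (tf2 T α) (tf2 T β).
Proof. intros []; constructor. Qed.

Lemma tf2_comp (K L : TwoCategory) (T : TwoFunctor K L) (A B : K)
  (f f' f'' : thom A B) (β : Hom f' f'') (α : Hom f f') :
  tf2 T (β ∘ α) = tf2 T β ∘ tf2 T α.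
Proof. apply fmap_comp. Qed.

Lemma tf2_id (K L : TwoCategory) (T : TwoFunctor K L) (A B : K) (f : thom A B) :
  tf2 T (idm f) = idm (tf1 T f).
Proof. exact (fmap_id (tfhom T A B) f). Qed.

Lemma heq_tf2_paste (K L : TwoCategory) (T : TwoFunctor K L) (A B : K)
  (g g1 g1' g2 : thom A B) (e : g1 = g1') (e' : tf1 T g1 = tf1 T g1')
  (β' : Hom g1' g2) (β : Hom g g1) :
  heq (tf2 T (β' ∘[e] β)) (tf2 T β' ∘[e'] tf2 T β).
Proof.
destruct e; rewrite (proof_irrelevance _ e' eq_refl); unfold paste; simpl.
rewrite !comp_idl, tf2_comp; constructor.
Qed.

Definition IdTF (K : TwoCategory) : TwoFunctor K K.
Proof.
refine {| tfob := fun A => A; tfhom := fun A B => IdF (thom A B) |};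
  abstract (intros; constructor).
Defined.

Definition CompTF (K L M : TwoCategory) (G : TwoFunctor L M) (F : TwoFunctor K L) :
  TwoFunctor K M.
Proof.
refine {| tfob := fun A => G (F A);
  tfhom := fun A B => CompF (tfhom G (F A) (F B)) (tfhom F A B) |}.
- abstract (intros; simpl; now rewrite !tf_id).
- abstract (intros; simpl; now rewrite !tf_comp).
- abstract (intros; eapply heq_trans;
    [exact (heq_tf2 G (tf_comp2 F β α)) | apply tf_comp2]).
Defined.

Record TwoNat (K L : TwoCategory) (F G : TwoFunctor K L) := {
  tn_app :> forall A, thom (F A) (G A);
  tn_nat1 : forall A B (f : thom A B), tn_app B · tf1 F f = tf1 G f · tn_app A;
  tn_nat2 : forall A B (f g : thom A B) (α : Hom f g),
    heq (tn_app B ◃ tf2 F α) (tf2 G α ▹ tn_app A) }.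

Definition two_natural_iso (K L : TwoCategory) (F G : TwoFunctor K L)
  (θ : TwoNat F G) : Prop :=
  forall A, exists θ' : thom (G A) (F A), θ' · θ A = tid (F A) /\ θ A · θ' = tid (G A).

(** The components of [U θ] are identities; in particular [U (G A) = U (F A)]. *)
Definition lies_over_id (K L M : TwoCategory) (F G : TwoFunctor K L)
  (U : TwoFunctor L M) (θ : TwoNat F G) : Prop :=
  forall A, existT (fun B => Ob (thom (U (F A)) B)) (U (G A)) (tf1 U (θ A))
          = existT (fun B => Ob (thom (U (F A)) B)) (U (F A)) (tid (U (F A))).

(** Equivalence in the slice over [K]: the 2-functors commute strictly with [U] and
    [V], and the 2-natural isomorphisms lie over identities. *)
Definition two_equivalent_over (K A B : TwoCategory) (U : TwoFunctor A K)
  (V : TwoFunctor B K) : Prop :=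
  exists (Φ : TwoFunctor A B) (Ψ : TwoFunctor B A),
    CompTF V Φ = U /\ CompTF U Ψ = V /\
    (exists η : TwoNat (IdTF A) (CompTF Ψ Φ),
       two_natural_iso η /\ lies_over_id U η) /\
    (exists ε : TwoNat (CompTF Φ Ψ) (IdTF B),
       two_natural_iso ε /\ lies_over_id V ε).

Record TwoMonad (K : TwoCategory) := {
  tm_fun :> TwoFunctor K K;
  tm_unit : TwoNat (IdTF K) tm_fun;
  tm_mult : TwoNat (CompTF tm_fun tm_fun) tm_fun;
  tm_assoc : forall A, tm_mult A · tf1 tm_fun (tm_mult A) = tm_mult A · tm_mult (tm_fun A);
  tm_unitl : forall A, tm_mult A · tm_unit (tm_fun A) = tid (tm_fun A);
  tm_unitr : forall A, tm_mult A · tf1 tm_fun (tm_unit A) = tid (tm_fun A) }.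

Definition tm_eta (K : TwoCategory) (T : TwoMonad K) (A : K) : thom A (T A) :=
  tm_unit T A.

Definition tm_mu (K : TwoCategory) (T : TwoMonad K) (A : K) : thom (T (T A)) (T A) :=
  tm_mult T A.

(** Reasoning modulo [heq]: arrows are packed with their source and target, and
    composition becomes an associative operation, undefined composites being
    [None]. *)
Definition arrow (C : Category) : Type := {A : C & {B : C & Hom A B}}.

Definition pk (C : Category) (A B : C) (f : Hom A B) : option (arrow C) :=
  Some (existT _ A (existT _ B f)).

Definition vc (C : Category) (y x : option (arrow C)) : option (arrow C) :=
  match y, x with
  | Some (existT _ B' (existT _ D g)), Some (existT _ A (existT _ B f)) =>
      match excluded_middle_informative (B = B') with
      | left e => pk (g ∘[e] f)
      | right _ => None
      end
  | _, _ => None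
  end.
Local Notation "y ⊙ x" := (vc y x) (at level 40, left associativity).

Lemma pk_heq (C : Category) (A B A' B' : C) (f : Hom A B) (f' : Hom A' B') :
  heq f f' -> pk f = pk f'.
Proof. now intros []. Qed.

Lemma heq_pk (C : Category) (A B A' B' : C) (f : Hom A B) (f' : Hom A' B') :
  pk f = pk f' -> heq f f'.
Proof.
intros H.
change (match pk f' with
        | Some (existT _ _ (existT _ _ x)) => heq f x | None => True end).
rewrite <- H; constructor.
Qed.

Lemma pk_paste (C : Category) (A B B' D : C) (e : B = B') (g : Hom B' D) (f : Hom A B) :
  pk (g ∘[e] f) = pk g ⊙ pk f.
Proof.
simpl; destruct (excluded_middle_informative (B = B')) as [e'|n]; [|easy].
now rewrite (proof_irrelevance _ e e').
Qed.

Lemma pk_comp (C : Category) (A B D : C) (g : Hom B D) (f : Hom A B) :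
  pk (g ∘ f) = pk g ⊙ pk f.
Proof.
rewrite <- (pk_paste eq_refl); unfold paste; simpl; now rewrite comp_idl.
Qed.

Lemma vc_assoc (C : Category) (z y x : option (arrow C)) : z ⊙ y ⊙ x = z ⊙ (y ⊙ x).
Proof.
destruct z as [[C1 [C2 h]]|], y as [[B1 [B2 g]]|], x as [[A1 [A2 f]]|]; try easy;
  simpl; destruct (excluded_middle_informative (B2 = C1)) as [e|n]; simpl; trivial;
  destruct (excluded_middle_informative (A2 = B1)) as [e'|n']; simpl; trivial;
  destruct (excluded_middle_informative (B2 = C1)) as [e1|n1]; simpl; trivial;
  try contradiction.
now rewrite paste_assoc, (proof_irrelevance _ e e1).
Qed.

Lemma vc_idl (C : Category) (A B B' : C) (f : Hom A B) : B = B' -> pk (idm B') ⊙ pk f = pk f.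
Proof. intros <-; rewrite <- pk_comp; now rewrite comp_idl. Qed.

Lemma vc_idr (C : Category) (A A' B : C) (f : Hom A B) : A = A' -> pk f ⊙ pk (idm A') = pk f.
Proof. intros <-; rewrite <- pk_comp; now rewrite comp_idr. Qed.

Lemma pk_whiskr (K : TwoCategory) (A B C : K) (g g1 g1' g2 : thom B C) (f : thom A B)
  (e : g1 = g1') (β' : Hom g1' g2) (β : Hom g g1) :
  pk ((β' ∘[e] β) ▹ f) = pk (β' ▹ f) ⊙ pk (β ▹ f).
Proof.
destruct e; unfold paste; cbn [eqmor]; rewrite comp_idl, <- pk_comp.
now rewrite <- tcomp2_comp, comp_idl.
Qed.

Lemma pk_whiskl (K : TwoCategory) (A B C : K) (g : thom B C) (f f1 f1' f2 : thom A B)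
  (e : f1 = f1') (β' : Hom f1' f2) (β : Hom f f1) :
  pk (g ◃ (β' ∘[e] β)) = pk (g ◃ β') ⊙ pk (g ◃ β).
Proof.
destruct e; unfold paste; cbn [eqmor]; rewrite comp_idl, <- pk_comp.
now rewrite <- tcomp2_comp, comp_idl.
Qed.

Lemma pk_slide (K : TwoCategory) (A B C : K) (g g' : thom B C) (f f' : thom A B)
  (β : Hom g g') (α : Hom f f') :
  pk (g' ◃ α) ⊙ pk (β ▹ f) = pk (β ▹ f') ⊙ pk (g ◃ α).
Proof. rewrite <- !pk_comp, <- !tcomp2_comp. now rewrite !comp_idl, !comp_idr. Qed.

Arguments pk : simpl never.
Arguments vc : simpl never.

Lemma pk_star_comp (K : TwoCategory) (A B C : K) (g g' g'' : thom B C)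
  (f f' f'' : thom A B) (β' : Hom g' g'') (β : Hom g g') (α' : Hom f' f'')
  (α : Hom f f') : pk ((β' ∘ β) ⋆ (α' ∘ α)) = pk (β' ⋆ α') ⊙ pk (β ⋆ α).
Proof. now rewrite tcomp2_comp, pk_comp. Qed.

Lemma pk_star_assoc (K : TwoCategory) (A B C D : K) (h h' : thom C D) (g g' : thom B C)
  (f f' : thom A B) (γ : Hom h h') (β : Hom g g') (α : Hom f f') :
  pk (γ ⋆ β ⋆ α) = pk (γ ⋆ (β ⋆ α)).
Proof. apply pk_heq, tcomp2A. Qed.

Lemma pk_star (K : TwoCategory) (A B C : K) (g1 g1' g2 g2' : thom B C)
  (f1 f1' f2 f2' : thom A B) (β1 : Hom g1 g1') (β2 : Hom g2 g2')
  (α1 : Hom f1 f1') (α2 : Hom f2 f2') :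
  pk β1 = pk β2 -> pk α1 = pk α2 -> pk (β1 ⋆ α1) = pk (β2 ⋆ α2).
Proof. intros H1 H2; apply pk_heq, heq_tcomp2; now apply heq_pk. Qed.

Lemma pk_idm (C : Category) (A B : C) : A = B -> pk (idm A) = pk (idm B).
Proof. now intros <-. Qed.

Lemma pk_eqmor (C : Category) (A B : C) (e : A = B) : pk (eqmor e) = pk (idm A).
Proof. apply pk_heq, heq_eqmor. Qed.

Lemma pk_whiskrr (K : TwoCategory) (A B C D : K) (h h' : thom C D) (g : thom B C)
  (f : thom A B) (γ : Hom h h') : pk (γ ▹ g ▹ f) = pk (γ ▹ (g · f)).
Proof. rewrite pk_star_assoc; now rewrite tcomp2_id. Qed.

Lemma pk_whiskll (K : TwoCategory) (A B C D : K) (h : thom C D) (g : thom B C)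
  (f f' : thom A B) (α : Hom f f') : pk (h ◃ (g ◃ α)) = pk (h · g ◃ α).
Proof. rewrite <- pk_star_assoc; now rewrite tcomp2_id. Qed.

Section PseudoAlgebras.

Context (K : TwoCategory) (T : TwoMonad K).
Local Notation η := (tm_eta T).
Local Notation μ := (tm_mu T).
Local Notation T1 := (tf1 T).
Local Notation T2 := (tf2 T).

Lemma unit_nat (A B : K) (f : thom A B) : η B · f = T1 f · η A.
Proof. exact (tn_nat1 (tm_unit T) f). Qed.

Lemma mult_nat (A B : K) (f : thom A B) : μ B · T1 (T1 f) = T1 f · μ A.
Proof. exact (tn_nat1 (tm_mult T) f). Qed.

Lemma unit_nat2 (A B : K) (f g : thom A B) (α : Hom f g) : heq (η B ◃ α) (T2 α ▹ η A).
Proof. exact (tn_nat2 (tm_unit T) α). Qed.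

Lemma mult_nat2 (A B : K) (f g : thom A B) (α : Hom f g) :
  heq (μ B ◃ T2 (T2 α)) (T2 α ▹ μ A).
Proof. exact (tn_nat2 (tm_mult T) α). Qed.

Lemma T1_comp (A B C : K) (g : thom B C) (f : thom A B) : T1 (g · f) = T1 g · T1 f.
Proof. exact (tf_comp T g f). Qed.

Lemma T1_id (A : K) : T1 (tid A) = tid (T A).
Proof. exact (tf_id T A). Qed.

Lemma T2_comp2 (A B C : K) (g g' : thom B C) (f f' : thom A B)
  (β : Hom g g') (α : Hom f f') : heq (T2 (β ⋆ α)) (T2 β ⋆ T2 α).
Proof. exact (tf_comp2 T β α). Qed.

(** The equalities of 1-cells along which the coherence pastings are formed. *)
Lemma slide_unit (A B C : K) (c : thom (T B) C) (f : thom A B) :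
  c · η B · f = c · T1 f · η A.
Proof. now rewrite !tcomp1A, unit_nat. Qed.

Lemma slide_mult (A B C : K) (c : thom (T B) C) (f : thom A B) :
  c · μ B · T1 (T1 f) = c · T1 f · μ A.
Proof. now rewrite !tcomp1A, mult_nat. Qed.

Lemma split_act (A B C D : K) (c : thom (T C) D) (g : thom B C) (f : thom A B) :
  c · T1 (g · f) = c · T1 g · T1 f.
Proof. now rewrite T1_comp, tcomp1A. Qed.

Record PsAlgebra := {
  pa_car :> K;
  pa_act : thom (T pa_car) pa_car;
  pa_unit : Hom (tid pa_car) (pa_act · η pa_car);
  pa_mult : Hom (pa_act · T1 pa_act) (pa_act · μ pa_car);
  pa_unit_iso : is_iso pa_unit;
  pa_mult_iso : is_iso pa_mult;
  pa_coh_mult :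
    heq ((pa_mult ▹ μ (T pa_car)) ∘[slide_mult pa_act pa_act]
           (pa_mult ▹ T1 (T1 pa_act)))
        ((pa_mult ▹ T1 (μ pa_car)) ∘[split_act pa_act pa_act (μ pa_car)]
           (pa_act ◃ T2 pa_mult));
  pa_coh_unitl :
    heq ((pa_mult ▹ η (T pa_car)) ∘[slide_unit pa_act pa_act]
           (pa_unit ▹ pa_act))
        (idm pa_act);
  pa_coh_unitr :
    heq ((pa_mult ▹ T1 (η pa_car)) ∘[split_act pa_act pa_act (η pa_car)]
           (pa_act ◃ T2 pa_unit))
        (idm pa_act) }.

Record PsMorphism (A B : PsAlgebra) := {
  pm_cell :> thom (pa_car A) (pa_car B);
  pm_str : Hom (pa_act B · T1 pm_cell) (pm_cell · pa_act A);
  pm_str_iso : is_iso pm_str;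
  pm_coh_mult :
    heq ((pm_str ▹ μ A) ∘[slide_mult (pa_act B) pm_cell]
           (pa_mult B ▹ T1 (T1 pm_cell)))
        ((pm_cell ◃ pa_mult A) ∘[tcomp1A pm_cell (pa_act A) (T1 (pa_act A))]
           ((pm_str ▹ T1 (pa_act A)) ∘[split_act (pa_act B) pm_cell (pa_act A)]
              (pa_act B ◃ T2 pm_str)));
  pm_coh_unit :
    heq ((pm_str ▹ η A) ∘[slide_unit (pa_act B) pm_cell] (pa_unit B ▹ pm_cell))
        (pm_cell ◃ pa_unit A) }.

Definition is_alg_cell (A B : PsAlgebra) (f g : PsMorphism A B)
  (σ : Hom (pm_cell f) (pm_cell g)) : Prop :=
  pm_str g ∘ (pa_act B ◃ T2 σ) = (σ ▹ pa_act A) ∘ pm_str f.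

Record AlgCell (A B : PsAlgebra) (f g : PsMorphism A B) := {
  ac_cell :> Hom (pm_cell f) (pm_cell g);
  ac_coh : is_alg_cell ac_cell }.

Lemma alg_cell_ext (A B : PsAlgebra) (f g : PsMorphism A B) (σ τ : AlgCell f g) :
  ac_cell σ = ac_cell τ -> σ = τ.
Proof.
destruct σ as [s p], τ as [t q]; simpl; intros <-; f_equal; apply proof_irrelevance.
Qed.

Lemma psmor_ext (A B : PsAlgebra) (f g : PsMorphism A B) :
  pm_cell f = pm_cell g -> heq (pm_str f) (pm_str g) -> f = g.
Proof.
destruct f as [f φ p1 p2 p3], g as [g ψ q1 q2 q3]; simpl; intros <- H.
apply heq_eq in H; destruct H; f_equal; apply proof_irrelevance.
Qed.

Definition ac_id (A B : PsAlgebra) (f : PsMorphism A B) : AlgCell f f.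
Proof.
refine {| ac_cell := idm (pm_cell f) |}.
abstract (unfold is_alg_cell; rewrite tf2_id, !tcomp2_id, comp_idl, comp_idr;
  reflexivity).
Defined.

Definition ac_comp (A B : PsAlgebra) (f g h : PsMorphism A B) (τ : AlgCell g h)
  (σ : AlgCell f g) : AlgCell f h.
Proof.
refine {| ac_cell := ac_cell τ ∘ ac_cell σ |}.
abstract (unfold is_alg_cell; rewrite tf2_comp,
  <- (comp_idl (idm (pa_act B))), <- (comp_idl (idm (pa_act A))), !tcomp2_comp,
  <- comp_assoc, (ac_coh τ), comp_assoc, (ac_coh σ), comp_assoc; reflexivity).
Defined.

Definition AlgCat (A B : PsAlgebra) : Category.
Proof.
refine {| Ob := PsMorphism A B; Hom := @AlgCell A B; idm := @ac_id A B;
  comp := @ac_comp A B |}.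
- abstract (intros; apply alg_cell_ext, comp_assoc).
- abstract (intros; apply alg_cell_ext, comp_idl).
- abstract (intros; apply alg_cell_ext, comp_idr).
Defined.

Lemma heq_algcat (A B : PsAlgebra) (f g f' g' : AlgCat A B)
  (σ : Hom f g) (τ : Hom f' g') :
  f = f' -> g = g' -> heq (ac_cell σ) (ac_cell τ) -> heq σ τ.
Proof.
intros e e' H; subst f' g'; apply heq_eq in H.
apply alg_cell_ext in H; subst; constructor.
Qed.


Lemma pk_T2 (A B : K) (f f' g g' : thom A B) (α : Hom f f') (β : Hom g g') :
  pk α = pk β -> pk (T2 α) = pk (T2 β).
Proof. intros H; now apply pk_heq, heq_tf2, heq_pk. Qed.

Lemma pk_T2_star (A B C : K) (g g' : thom B C) (f f' : thom A B)
  (β : Hom g g') (α : Hom f f') : pk (T2 (β ⋆ α)) = pk (T2 β ⋆ T2 α).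
Proof. apply pk_heq, T2_comp2. Qed.

Lemma T1_paste_eq (A B : K) (f g : thom A B) : f = g -> T1 f = T1 g.
Proof. now intros ->. Qed.

Definition pm_id_eq (A : PsAlgebra) :
  pa_act A · T1 (tid (pa_car A)) = tid (pa_car A) · pa_act A :=
  eq_trans (eq_trans (f_equal (tcomp1 (pa_act A)) (T1_id A)) (tcomp1r (pa_act A)))
    (eq_sym (tcomp1l (pa_act A))).

Lemma pm_id_coh_mult (A : PsAlgebra) :
  heq ((eqmor (pm_id_eq A) ▹ μ A) ∘[slide_mult (pa_act A) (tid (pa_car A))]
         (pa_mult A ▹ T1 (T1 (tid (pa_car A)))))
      ((tid (pa_car A) ◃ pa_mult A)
         ∘[tcomp1A (tid (pa_car A)) (pa_act A) (T1 (pa_act A))]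
         ((eqmor (pm_id_eq A) ▹ T1 (pa_act A))
            ∘[split_act (pa_act A) (tid (pa_car A)) (pa_act A)]
            (pa_act A ◃ T2 (eqmor (pm_id_eq A))))).
Proof.
apply heq_pk; rewrite !pk_paste.
rewrite (pk_star (pk_eqmor (pm_id_eq A)) (eq_refl (pk (idm (μ A))))), tcomp2_id.
rewrite (pk_star (pk_eqmor (pm_id_eq A)) (eq_refl (pk (idm (T1 (pa_act A)))))), tcomp2_id.
rewrite (pk_star (eq_refl (pk (idm (pa_act A)))) (pk_T2 (pk_eqmor (pm_id_eq A)))),
  tf2_id, tcomp2_id.
rewrite (vc_idl (pa_mult A ▹ T1 (T1 (tid (pa_car A))))) by apply slide_mult.
rewrite vc_idl by now rewrite !T1_id, !tcomp1r.
rewrite vc_idr by now rewrite T1_id, tcomp1r, tcomp1l.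
rewrite (pk_heq (tcomp2l (pa_mult A))).
rewrite (@pk_star _ _ _ _ _ _ _ _ _ _ _ _ (pa_mult A) (pa_mult A)
  (idm (T1 (T1 (tid (pa_car A))))) (idm (tid (T (T (pa_car A)))))); trivial.
- apply pk_heq, tcomp2r.
- apply pk_idm; now rewrite !T1_id.
Qed.

Lemma pm_id_coh_unit (A : PsAlgebra) :
  heq ((eqmor (pm_id_eq A) ▹ η A) ∘[slide_unit (pa_act A) (tid (pa_car A))]
         (pa_unit A ▹ tid (pa_car A)))
      (tid (pa_car A) ◃ pa_unit A).
Proof.
apply heq_pk; rewrite pk_paste.
rewrite (pk_star (pk_eqmor (pm_id_eq A)) (eq_refl (pk (idm (η A))))), tcomp2_id.
rewrite vc_idl by apply slide_unit.
rewrite (pk_heq (tcomp2l (pa_unit A))); apply pk_heq, tcomp2r.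
Qed.

Definition pm_id (A : PsAlgebra) : PsMorphism A A :=
  {| pm_cell := tid (pa_car A); pm_str := eqmor (pm_id_eq A);
     pm_str_iso := is_iso_eqmor (pm_id_eq A);
     pm_coh_mult := pm_id_coh_mult A; pm_coh_unit := pm_id_coh_unit A |}.

(** The structure cell of a composite: [c·T(gf) = c·Tg·Tf ⇒ g·b·Tf ⇒ g·f·a]. *)
Definition pm_comp_str (A B C : PsAlgebra) (g : PsMorphism B C) (f : PsMorphism A B) :
  Hom (pa_act C · T1 (pm_cell g · pm_cell f)) (pm_cell g · pm_cell f · pa_act A) :=
  eqmor (eq_sym (tcomp1A (pm_cell g) (pm_cell f) (pa_act A))) ∘
  ((pm_cell g ◃ pm_str f) ∘[tcomp1A (pm_cell g) (pa_act B) (T1 (pm_cell f))]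
   (pm_str g ▹ T1 (pm_cell f))) ∘
  eqmor (split_act (pa_act C) (pm_cell g) (pm_cell f)).

Lemma heq_pm_comp_str (A B C : PsAlgebra) (g : PsMorphism B C) (f : PsMorphism A B) :
  heq (pm_comp_str g f)
    ((pm_cell g ◃ pm_str f) ∘[tcomp1A (pm_cell g) (pa_act B) (T1 (pm_cell f))]
     (pm_str g ▹ T1 (pm_cell f))).
Proof.
unfold pm_comp_str.
eapply heq_trans; [apply heq_comp_eqmorr | apply heq_comp_eqmorl].
Qed.

Lemma pk_pm_comp_str (A B C : PsAlgebra) (g : PsMorphism B C) (f : PsMorphism A B) :
  pk (pm_comp_str g f) =
  pk (pm_cell g ◃ pm_str f) ⊙ pk (pm_str g ▹ T1 (pm_cell f)).
Proof. rewrite (pk_heq (heq_pm_comp_str g f)); apply pk_paste. Qed.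

Lemma pk_pm_comp_whiskr (A B C : PsAlgebra) (g : PsMorphism B C) (f : PsMorphism A B)
  (X : K) (h : thom X (T A)) :
  pk (pm_comp_str g f ▹ h) =
  pk (pm_cell g ◃ (pm_str f ▹ h)) ⊙ pk (pm_str g ▹ (T1 (pm_cell f) · h)).
Proof.
rewrite (pk_star (pk_heq (heq_pm_comp_str g f)) (eq_refl (pk (idm h)))).
now rewrite pk_whiskr, pk_star_assoc, pk_whiskrr.
Qed.

Lemma pm_comp_coh_mult (A B C : PsAlgebra) (g : PsMorphism B C) (f : PsMorphism A B) :
  pk (pm_comp_str g f ▹ μ A) ⊙ pk (pa_mult C ▹ T1 (T1 (pm_cell g · pm_cell f))) =
  pk (pm_cell g · pm_cell f ◃ pa_mult A) ⊙
    (pk (pm_comp_str g f ▹ T1 (pa_act A)) ⊙ pk (pa_act C ◃ T2 (pm_comp_str g f))).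
Proof.
rewrite !pk_pm_comp_whiskr.
pose proof (pk_heq (pm_coh_mult g)) as Hg; pose proof (pk_heq (pm_coh_mult f)) as Hf.
assert (E1 : pk (pa_mult C ▹ T1 (T1 (pm_cell g · pm_cell f)))
  = pk (pa_mult C ▹ T1 (T1 (pm_cell g)) ▹ T1 (T1 (pm_cell f)))).
{ rewrite pk_whiskrr; apply pk_star; trivial; apply pk_idm; now rewrite !T1_comp. }
assert (E2 : pk (pm_str g ▹ (T1 (pm_cell f) · μ A))
  = pk (pm_str g ▹ μ B ▹ T1 (T1 (pm_cell f)))).
{ rewrite pk_whiskrr; apply pk_star; trivial; apply pk_idm; now rewrite mult_nat. }
rewrite E1, E2, !vc_assoc, <- (pk_whiskr _ (slide_mult _ _)).
rewrite (pk_star Hg (eq_refl _)), !pk_whiskr, pk_star_assoc.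
rewrite <- vc_assoc, <- (pk_whiskl _ (slide_mult _ _)), (pk_star (eq_refl _) Hf),
  !pk_whiskl, pk_whiskll, !vc_assoc.
do 2 f_equal.
assert (E3 : pk (pa_act C ◃ T2 (pm_comp_str g f)) =
   pk (pa_act C · T1 (pm_cell g) ◃ T2 (pm_str f)) ⊙
   pk (pa_act C ◃ T2 (pm_str g) ▹ T1 (T1 (pm_cell f)))).
{ rewrite (pk_star (eq_refl (pk (idm (pa_act C))))
    (pk_heq (heq_trans (heq_tf2 T (heq_pm_comp_str g f))
       (heq_tf2_paste (tcomp1A _ _ _) (T1_paste_eq (tcomp1A _ _ _)) _ _)))).
  rewrite pk_whiskl, <- pk_whiskll, pk_star_assoc.
  f_equal; (apply pk_star; [reflexivity|]); rewrite pk_T2_star, tf2_id; reflexivity. }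
rewrite E3, <- !vc_assoc; f_equal.
rewrite pk_whiskll, pk_whiskrr.
rewrite (@pk_star _ _ _ _ _ _ _ _ _ _ _ _ (pm_str g) (pm_str g)
  (idm (T1 (pa_act B) · T1 (T1 (pm_cell f)))) (idm (T1 (pa_act B · T1 (pm_cell f)))));
  trivial; [|now apply pk_idm; rewrite T1_comp].
rewrite (@pk_star _ _ _ _ _ _ _ _ _ _ _ _ (pm_str g) (pm_str g)
  (idm (T1 (pm_cell f) · T1 (pa_act A))) (idm (T1 (pm_cell f · pa_act A))));
  trivial; [|now apply pk_idm; rewrite T1_comp].
apply pk_slide.
Qed.

Lemma pm_comp_coh_unit (A B C : PsAlgebra) (g : PsMorphism B C) (f : PsMorphism A B) :
  pk (pm_comp_str g f ▹ η A) ⊙ pk (pa_unit C ▹ (pm_cell g · pm_cell f)) =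
  pk (pm_cell g · pm_cell f ◃ pa_unit A).
Proof.
rewrite pk_pm_comp_whiskr.
pose proof (pk_heq (pm_coh_unit g)) as Hg; pose proof (pk_heq (pm_coh_unit f)) as Hf.
assert (E2 : pk (pm_str g ▹ (T1 (pm_cell f) · η A))
  = pk (pm_str g ▹ η B ▹ pm_cell f)).
{ rewrite pk_whiskrr; apply pk_star; trivial; apply pk_idm; now rewrite unit_nat. }
rewrite E2, <- pk_whiskrr, vc_assoc, <- (pk_whiskr _ (slide_unit _ _)).
rewrite (pk_star Hg (eq_refl _)), pk_star_assoc.
rewrite <- (pk_whiskl _ (slide_unit _ _)), (pk_star (eq_refl _) Hf).
now rewrite pk_whiskll.
Qed.

Definition pm_comp (A B C : PsAlgebra) (g : PsMorphism B C) (f : PsMorphism A B) :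
  PsMorphism A C.
Proof.
refine {| pm_cell := pm_cell g · pm_cell f; pm_str := pm_comp_str g f |}.
- abstract (apply is_iso_comp; [apply is_iso_comp; [apply is_iso_eqmor|]
    |apply is_iso_eqmor]; apply is_iso_paste; unfold tcomp2; apply is_iso_fmap;
   [destruct (pm_str_iso f) as [x [Hx Hy]]; exists ⟨idm (pm_cell g), x⟩
   |destruct (pm_str_iso g) as [x [Hx Hy]]; exists ⟨x, idm (T1 (pm_cell f))⟩];
   simpl; rewrite Hx, Hy, !comp_idl; split; reflexivity).
- abstract (apply heq_pk; rewrite !pk_paste; apply pm_comp_coh_mult).
- abstract (apply heq_pk; rewrite !pk_paste; apply pm_comp_coh_unit).
Defined.

Lemma ac_hcomp_coh (A B C : PsAlgebra) (g g' : PsMorphism B C) (f f' : PsMorphism A B)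
  (τ : AlgCell g g') (σ : AlgCell f f') :
  @is_alg_cell A C (pm_comp g f) (pm_comp g' f') (ac_cell τ ⋆ ac_cell σ).
Proof.
apply heq_eq, heq_pk; rewrite !pk_comp; simpl; rewrite !pk_pm_comp_str.
assert (E1 : pk (pa_act C ◃ T2 (ac_cell τ ⋆ ac_cell σ))
  = pk ((pa_act C ◃ T2 (ac_cell τ)) ⋆ T2 (ac_cell σ))).
{ rewrite pk_star_assoc; apply pk_star; trivial; apply pk_T2_star. }
rewrite E1, vc_assoc, <- pk_star_comp, (ac_coh τ), comp_idl,
  <- (comp_idr (T2 (ac_cell σ))), pk_star_comp, pk_star_assoc.
rewrite <- vc_assoc, <- pk_star_comp, (ac_coh σ), comp_idl,
  <- (comp_idr (ac_cell τ)) at 1.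
now rewrite pk_star_comp, <- pk_star_assoc, vc_assoc.
Qed.

Definition ac_hcomp (A B C : PsAlgebra) (g g' : PsMorphism B C) (f f' : PsMorphism A B)
  (τ : AlgCell g g') (σ : AlgCell f f') : AlgCell (pm_comp g f) (pm_comp g' f') :=
  @Build_AlgCell A C (pm_comp g f) (pm_comp g' f') (ac_cell τ ⋆ ac_cell σ)
    (ac_hcomp_coh τ σ).

Definition AlgComp (A B C : PsAlgebra) :
  Functor (ProdCat (AlgCat B C) (AlgCat A B)) (AlgCat A C).
Proof.
refine {| fob := fun X : ProdCat (AlgCat B C) (AlgCat A B) =>
            (pm_comp (pr1 X) (pr2 X) : AlgCat A C);
          fmap := fun X Y σ => ac_hcomp (pr1 σ) (pr2 σ) |}.
- abstract (intros; apply alg_cell_ext; simpl; apply tcomp2_id).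
- abstract (intros; apply alg_cell_ext; simpl; apply tcomp2_comp).
Defined.

Lemma pm_comp_assoc (A B C D : PsAlgebra) (h : PsMorphism C D) (g : PsMorphism B C)
  (f : PsMorphism A B) : pm_comp (pm_comp h g) f = pm_comp h (pm_comp g f).
Proof.
apply psmor_ext; [apply tcomp1A|]; simpl; apply heq_pk.
refine (eq_trans (pk_pm_comp_str (pm_comp h g) f)
  (eq_trans _ (eq_sym (pk_pm_comp_str h (pm_comp g f))))); simpl.
rewrite pk_pm_comp_whiskr.
rewrite (pk_star (eq_refl (pk (idm (pm_cell h)))) (pk_heq (heq_pm_comp_str g f))),
  pk_whiskl, pk_whiskll, vc_assoc.
do 2 f_equal; apply pk_star; trivial; apply pk_idm; now rewrite T1_comp.
Qed.

Lemma pm_comp_idl (A B : PsAlgebra) (f : PsMorphism A B) : pm_comp (pm_id B) f = f.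
Proof.
apply psmor_ext; [apply tcomp1l|]; simpl; apply heq_pk.
refine (eq_trans (pk_pm_comp_str (pm_id B) f) _); simpl.
rewrite (pk_heq (tcomp2l (pm_str f))).
rewrite (pk_star (pk_eqmor (pm_id_eq B)) (eq_refl _)), tcomp2_id.
apply vc_idr; now rewrite T1_id, tcomp1r.
Qed.

Lemma pm_comp_idr (A B : PsAlgebra) (f : PsMorphism A B) : pm_comp f (pm_id A) = f.
Proof.
apply psmor_ext; [apply tcomp1r|]; simpl; apply heq_pk.
refine (eq_trans (pk_pm_comp_str f (pm_id A)) _); simpl.
rewrite (pk_star (eq_refl _) (pk_eqmor (pm_id_eq A))), tcomp2_id.
rewrite (@pk_star _ _ _ _ _ _ _ _ _ _ _ _ (pm_str f) (pm_str f)
  (idm (T1 (tid (pa_car A)))) (idm (tid (T A)))); trivial;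
  [|apply pk_idm, T1_id].
rewrite (pk_heq (tcomp2r (pm_str f))).
apply vc_idl; now rewrite T1_id, tcomp1r.
Qed.

Definition PsAlg : TwoCategory.
Proof.
refine {| tob := PsAlgebra; thom := AlgCat; tid := pm_id; tcomp := AlgComp;
  tassoc := pm_comp_assoc; tidl := pm_comp_idl; tidr := pm_comp_idr |}.
- abstract (intros; apply heq_algcat; [apply pm_comp_assoc | apply pm_comp_assoc
    | apply tcomp2A]).
- abstract (intros; apply heq_algcat; [apply pm_comp_idl | apply pm_comp_idl
    | apply tcomp2l]).
- abstract (intros; apply heq_algcat; [apply pm_comp_idr | apply pm_comp_idr
    | apply tcomp2r]).
Defined.

Definition PsAlgForgetHom (A B : PsAlgebra) :
  Functor (AlgCat A B) (thom (pa_car A) (pa_car B)).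
Proof.
refine {| fob := fun f : AlgCat A B => pm_cell f; fmap := fun f g σ => ac_cell σ |};
  abstract reflexivity.
Defined.

Definition PsAlgForget : TwoFunctor PsAlg K.
Proof.
refine (@Build_TwoFunctor PsAlg K pa_car PsAlgForgetHom _ _ _);
  abstract (intros; constructor).
Defined.

End PseudoAlgebras.

Lemma heq_nt (C D : Category) (P : FunCat C D -> Prop) (F G F' G' : FullSub P)
  (α : Hom F G) (β : Hom F' G') :
  proj1_sig F = proj1_sig F' -> proj1_sig G = proj1_sig G' ->
  (forall X : C, heq (nt_app α X) (nt_app β X)) -> heq α β.
Proof.
destruct F as [F p], G as [G q], F' as [F' p'], G' as [G' q']; simpl in *.
intros <- <- H.
rewrite (proof_irrelevance _ p' p), (proof_irrelevance _ q' q).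
apply heq_of_eq, nt_ext; intros X; apply heq_eq, H.
Qed.

Lemma full_eq (C : Category) (P : C -> Prop) (X Y : FullSub P) :
  proj1_sig X = proj1_sig Y -> X = Y.
Proof.
destruct X as [X p], Y as [Y q]; simpl; intros <-; f_equal; apply proof_irrelevance.
Qed.

Section FunTwoCat.

Context (I : Type) (cat : I -> Category)
  (P : forall i j, FunCat (cat i) (cat j) -> Prop)
  (Pid : forall i, P i i (IdF (cat i)))
  (Pcomp : forall i j k (G : Functor (cat j) (cat k)) (F : Functor (cat i) (cat j)),
    P j k G -> P i j F -> P i k (CompF G F)).

Definition FunHComp (i j k : I) :
  Functor (ProdCat (FullSub (@P j k)) (FullSub (@P i j))) (FullSub (@P i k)).
Proof.
refine (@Build_Functor (ProdCat (FullSub (@P j k)) (FullSub (@P i j))) (FullSub (@P i k))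
  (fun X => exist _ (CompF (proj1_sig (pr1 X)) (proj1_sig (pr2 X)))
              (Pcomp (proj2_sig (pr1 X)) (proj2_sig (pr2 X))))
  (fun X Y σ => nt_hcomp (pr1 σ) (pr2 σ)) _ _).
- abstract (intros; apply nt_ext; intros; simpl; now rewrite fmap_id, comp_idl).
- abstract (intros X Y Z g f; apply nt_ext; intros; simpl;
    rewrite fmap_comp, !comp_assoc; f_equal;
    rewrite <- !comp_assoc; f_equal; apply nt_nat).
Defined.

(** The 2-category with objects [I], with 1-cells the functors satisfying [P] and
    with 2-cells all natural transformations. *)
Definition FunTwoCat : TwoCategory.
Proof.
refine (@Build_TwoCategory I (fun i j => FullSub (@P i j))
  (fun i => exist _ (IdF (cat i)) (Pid i)) FunHComp _ _ _ _ _ _).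
- abstract (intros; apply full_eq, functor_ext; constructor).
- abstract (intros; apply full_eq, functor_ext; constructor).
- abstract (intros; apply full_eq, functor_ext; constructor).
- abstract (intros; apply heq_nt; [apply functor_ext; constructor
    | apply functor_ext; constructor
    | intros; simpl; rewrite fmap_comp, comp_assoc; constructor]).
- abstract (intros; apply heq_nt; [apply functor_ext; constructor
    | apply functor_ext; constructor
    | intros; simpl; rewrite comp_idl; constructor]).
- abstract (intros; apply heq_nt; [apply functor_ext; constructor
    | apply functor_ext; constructor
    | intros; simpl; rewrite fmap_id, comp_idr; constructor]).
Defined.

End FunTwoCat.

Definition is_zero (C : Category) (Z : C) : Prop :=
  (forall X, exists f : Hom X Z, forall g : Hom X Z, g = f) /\
  (forall X, exists f : Hom Z X, forall g : Hom Z X, g = f).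

Definition preserves_zero (C D : Category) (F : FunCat C D) : Prop :=
  forall Z, is_zero Z -> is_zero (fob F Z).

#[projections(primitive)]
Record PointedCat := {
  pc_cat :> Category;
  pc_zero : exists Z : pc_cat, is_zero Z }.

Definition PointCat : TwoCategory :=
  @FunTwoCat PointedCat pc_cat (fun C D => @preserves_zero C D)
    (fun C Z H => H) (fun C D E G F HG HF Z H => HG _ (HF _ H)).

Lemma is_zero_pair (C D : Category) (Z : ProdCat C D) :
  is_zero Z <-> is_zero (pr1 Z) /\ is_zero (pr2 Z).
Proof.
destruct Z as [Z W]; simpl; split.
- intros [H K]; split; split; intros X.
  + destruct (H ⟨X, W⟩) as [f Hf]; exists (pr1 f); intros g.
    exact (f_equal (@pr1 _ _) (Hf ⟨g, pr2 f⟩)).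
  + destruct (K ⟨X, W⟩) as [f Hf]; exists (pr1 f); intros g.
    exact (f_equal (@pr1 _ _) (Hf ⟨g, pr2 f⟩)).
  + destruct (H ⟨Z, X⟩) as [f Hf]; exists (pr2 f); intros g.
    exact (f_equal (@pr2 _ _) (Hf ⟨pr1 f, g⟩)).
  + destruct (K ⟨Z, X⟩) as [f Hf]; exists (pr2 f); intros g.
    exact (f_equal (@pr2 _ _) (Hf ⟨pr1 f, g⟩)).
- intros [[H K] [H' K']]; split; intros [X Y].
  + destruct (H X) as [f Hf], (H' Y) as [g Hg]; exists ⟨f, g⟩; intros [u v].
    simpl in *; now rewrite (Hf u), (Hg v).
  + destruct (K X) as [f Hf], (K' Y) as [g Hg]; exists ⟨f, g⟩; intros [u v].
    simpl in *; now rewrite (Hf u), (Hg v).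
Qed.

Definition Square (C : PointedCat) : PointedCat.
Proof.
refine {| pc_cat := ProdCat C C |}.
abstract (destruct (pc_zero C) as [Z H]; exists ⟨Z, Z⟩; now apply is_zero_pair).
Defined.

Definition SquareFun (C D : Category) (F : Functor C D) :
  Functor (ProdCat C C) (ProdCat D D).
Proof.
refine (@Build_Functor (ProdCat C C) (ProdCat D D)
  (fun X => ⟨F (pr1 X), F (pr2 X)⟩) (fun X Y f => ⟨fmap F (pr1 f), fmap F (pr2 f)⟩) _ _).
- abstract (intros; simpl; now rewrite !fmap_id).
- abstract (intros; simpl; now rewrite !fmap_comp).
Defined.

Definition SquareNt (C D : Category) (F G : Functor C D) (α : NatTrans F G) :
  NatTrans (SquareFun F) (SquareFun G).
Proof.
refine (@Build_NatTrans _ _ (SquareFun F) (SquareFun G)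
  (fun X => ⟨α (pr1 X), α (pr2 X)⟩) _).
abstract (intros; simpl; now rewrite !nt_nat).
Defined.

Lemma square_preserves_zero (C D : Category) (F : Functor C D) :
  preserves_zero F -> preserves_zero (SquareFun F).
Proof.
intros H Z HZ; apply is_zero_pair in HZ; apply is_zero_pair; simpl; split; now apply H.
Qed.

Definition SquareHom (C D : PointedCat) :
  Functor (@thom PointCat C D) (@thom PointCat (Square C) (Square D)).
Proof.
refine (@Build_Functor (@thom PointCat C D) (@thom PointCat (Square C) (Square D))
  (fun F => exist _ (SquareFun (proj1_sig F)) (square_preserves_zero (proj2_sig F)))
  (fun F G α => SquareNt α) _ _);
  abstract (intros; apply nt_ext; reflexivity).
Defined.

Definition SquareTF : TwoFunctor PointCat PointCat.
Proof.
refine (@Build_TwoFunctor PointCat PointCat Square SquareHom _ _ _).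
- abstract (intros; apply full_eq, functor_ext; constructor).
- abstract (intros; apply full_eq, functor_ext; constructor).
- abstract (intros; apply heq_nt; [apply functor_ext; constructor
    | apply functor_ext; constructor | intros; constructor]).
Defined.

Definition Diag (C : Category) : Functor C (ProdCat C C).
Proof.
refine (@Build_Functor C (ProdCat C C) (fun X => ⟨X, X⟩) (fun X Y f => ⟨f, f⟩) _ _);
  abstract reflexivity.
Defined.

Definition Proj14 (C : Category) :
  Functor (ProdCat (ProdCat C C) (ProdCat C C)) (ProdCat C C).
Proof.
refine (@Build_Functor (ProdCat (ProdCat C C) (ProdCat C C)) (ProdCat C C)
  (fun X => ⟨pr1 (pr1 X), pr2 (pr2 X)⟩) (fun X Y f => ⟨pr1 (pr1 f), pr2 (pr2 f)⟩) _ _);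
  abstract reflexivity.
Defined.

Lemma diag_preserves_zero (C : Category) : preserves_zero (Diag C).
Proof. intros Z H; apply is_zero_pair; simpl; now split. Qed.

Definition SquareUnit : TwoNat (IdTF PointCat) SquareTF.
Proof.
refine (@Build_TwoNat _ _ (IdTF PointCat) SquareTF
  (fun C : PointedCat => exist _ (Diag C) (@diag_preserves_zero C))
  _ _).
- abstract (intros; apply full_eq, functor_ext; constructor).
- abstract (intros; apply heq_nt; [apply functor_ext; constructor
    | apply functor_ext; constructor
    | intros; simpl; rewrite !fmap_id, !comp_idl, !comp_idr; constructor]).
Defined.

Lemma proj14_preserves_zero (C : Category) : preserves_zero (Proj14 C).
Proof.
intros Z H; apply is_zero_pair in H; destruct H as [H K].
apply is_zero_pair in H; apply is_zero_pair in K; apply is_zero_pair; simpl; easy.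
Qed.

Definition SquareMult : TwoNat (CompTF SquareTF SquareTF) SquareTF.
Proof.
refine (@Build_TwoNat _ _ (CompTF SquareTF SquareTF) SquareTF
  (fun C : PointedCat => exist _ (Proj14 C) (@proj14_preserves_zero C)) _ _).
- abstract (intros; apply full_eq, functor_ext; constructor).
- abstract (intros; apply heq_nt; [apply functor_ext; constructor
    | apply functor_ext; constructor
    | intros; simpl; rewrite !fmap_id, !comp_idl, !comp_idr; constructor]).
Defined.

Definition Mstar : TwoMonad PointCat.
Proof.
refine (@Build_TwoMonad PointCat SquareTF SquareUnit SquareMult _ _ _);
  abstract (intros; apply full_eq, functor_ext; constructor).
Defined.

Section Null.

Context (C : Category) (Z : C -> Prop).

Definition null (X Y : C) (f : Hom X Y) : Prop :=
  exists W, Z W /\ exists (g : Hom X W) (h : Hom W Y), f = h ∘ g.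

Definition is_kernel (K X Y : C) (f : Hom X Y) (k : Hom K X) : Prop :=
  null (f ∘ k) /\
  forall W (u : Hom W X), null (f ∘ u) -> exists! v : Hom W K, k ∘ v = u.

Definition is_cokernel (X Y Q : C) (f : Hom X Y) (q : Hom Y Q) : Prop :=
  null (q ∘ f) /\
  forall W (u : Hom Y W), null (u ∘ f) -> exists! v : Hom Q W, v ∘ q = u.

Definition short_exact (A X B : C) (l : Hom A X) (r : Hom X B) : Prop :=
  is_kernel r l /\ is_cokernel l r.

Lemma null_compl (X Y W : C) (f : Hom X Y) (g : Hom Y W) : null f -> null (g ∘ f).
Proof.
intros [V [HV [a [b ->]]]]; exists V; split; [exact HV|].
exists a, (g ∘ b); now rewrite comp_assoc.
Qed.

Lemma null_compr (X Y W : C) (f : Hom X Y) (g : Hom W X) : null f -> null (f ∘ g).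
Proof.
intros [V [HV [a [b ->]]]]; exists V; split; [exact HV|].
exists (a ∘ g), b; now rewrite comp_assoc.
Qed.

Lemma kernel_mono (K X Y : C) (f : Hom X Y) (k : Hom K X) :
  is_kernel f k -> forall W (u v : Hom W K), k ∘ u = k ∘ v -> u = v.
Proof.
intros [H1 H2] W u v E.
destruct (H2 W (k ∘ u)) as [w [_ Hw]].
{ rewrite <- comp_assoc; now apply null_compr. }
now rewrite <- (Hw u eq_refl), <- (Hw v (eq_sym E)).
Qed.

Lemma cokernel_epi (X Y Q : C) (f : Hom X Y) (q : Hom Y Q) :
  is_cokernel f q -> forall W (u v : Hom Q W), u ∘ q = v ∘ q -> u = v.
Proof.
intros [H1 H2] W u v E.
destruct (H2 W (u ∘ q)) as [w [_ Hw]].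
{ rewrite comp_assoc; now apply null_compl. }
now rewrite <- (Hw u eq_refl), <- (Hw v (eq_sym E)).
Qed.

Lemma short_exact_iso (A A' X B B' : C) (l : Hom A X) (r : Hom X B)
  (i : Hom A' A) (j : Hom B B') :
  is_iso i -> is_iso j -> short_exact l r -> short_exact (l ∘ i) (j ∘ r).
Proof.
intros [i' [i1 i2]] [j' [j1 j2]] [Hk Hc].
pose proof (kernel_mono Hk) as Mk; pose proof (cokernel_epi Hc) as Ec.
destruct Hk as [N Hk], Hc as [_ Hc].
assert (N' : null (j ∘ r ∘ (l ∘ i))).
{ rewrite comp_assoc; apply null_compl; rewrite <- comp_assoc; now apply null_compr. }
split; split; trivial; intros W u Hu.
- destruct (Hk W u) as [v [Hv _]].
  { assert (E : r ∘ u = j' ∘ (j ∘ r ∘ u))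
      by now rewrite <- !comp_assoc, j1, comp_idl.
    rewrite E; now apply null_compl. }
  exists (i' ∘ v); split.
  + now rewrite comp_assoc, <- (comp_assoc i), i2, comp_idl.
  + intros v' Hv'. assert (E : v = i ∘ v')
      by (apply Mk; now rewrite Hv, <- Hv', comp_assoc).
    now rewrite E, <- comp_assoc, i1, comp_idl.
- destruct (Hc W u) as [v [Hv _]].
  { assert (E : u ∘ l = u ∘ (l ∘ i) ∘ i')
      by now rewrite !comp_assoc, i2, comp_idr.
    rewrite E; now apply null_compr. }
  exists (v ∘ j'); split.
  + now rewrite comp_assoc, <- (comp_assoc j'), j1, comp_idl.
  + intros v' Hv'. assert (E : v = v' ∘ j)
      by (apply Ec; now rewrite Hv, <- Hv', comp_assoc).
    now rewrite E, comp_assoc, j2, comp_idr.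
Qed.

End Null.

Record PretorsionTheory := {
  pt_cat :> Category;
  torsion : pt_cat -> Prop;
  torsionfree : pt_cat -> Prop;
  torsion_replete : forall X Y : pt_cat, isomorphic X Y -> torsion X -> torsion Y;
  torsionfree_replete :
    forall X Y : pt_cat, isomorphic X Y -> torsionfree X -> torsionfree Y;
  pt_null : forall (X Y : pt_cat) (f : Hom X Y), torsion X -> torsionfree Y ->
    null (fun Z => torsion Z /\ torsionfree Z) f;
  tpart : pt_cat -> pt_cat;
  fpart : pt_cat -> pt_cat;
  tpart_torsion : forall X, torsion (tpart X);
  fpart_torsionfree : forall X, torsionfree (fpart X);
  pt_l : forall X, Hom (tpart X) X;
  pt_r : forall X, Hom X (fpart X);
  pt_exact : forall X,
    short_exact (fun Z => torsion Z /\ torsionfree Z) (pt_l X) (pt_r X);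
  pt_l_torsion : forall X, torsion X -> heq (pt_l X) (idm X);
  pt_r_torsionfree : forall X, torsionfree X -> heq (pt_r X) (idm X) }.

Definition trivial_object (C : PretorsionTheory) (X : C) : Prop :=
  torsion X /\ torsionfree X.

Section Induced.

Context (C : PretorsionTheory).

Lemma tmap_ex (X Y : C) (h : Hom X Y) :
  exists! k : Hom (tpart X) (tpart Y), pt_l Y ∘ k = h ∘ pt_l X.
Proof.
apply (proj1 (pt_exact Y)); apply pt_null; [apply tpart_torsion | apply fpart_torsionfree].
Qed.

Lemma fmap_ex (X Y : C) (h : Hom X Y) :
  exists! k : Hom (fpart X) (fpart Y), k ∘ pt_r X = pt_r Y ∘ h.
Proof.
apply (proj2 (pt_exact X)); apply pt_null; [apply tpart_torsion | apply fpart_torsionfree].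
Qed.

Definition tmap (X Y : C) (h : Hom X Y) : Hom (tpart X) (tpart Y) :=
  proj1_sig (constructive_indefinite_description _ (tmap_ex h)).

Definition ffmap (X Y : C) (h : Hom X Y) : Hom (fpart X) (fpart Y) :=
  proj1_sig (constructive_indefinite_description _ (fmap_ex h)).

Lemma tmapE (X Y : C) (h : Hom X Y) : pt_l Y ∘ tmap h = h ∘ pt_l X.
Proof.
exact (proj1 (proj2_sig (constructive_indefinite_description _ (tmap_ex h)))).
Qed.

Lemma ffmapE (X Y : C) (h : Hom X Y) : ffmap h ∘ pt_r X = pt_r Y ∘ h.
Proof.
exact (proj1 (proj2_sig (constructive_indefinite_description _ (fmap_ex h)))).
Qed.

Lemma pt_l_mono (X W : C) (u v : Hom W (tpart X)) : pt_l X ∘ u = pt_l X ∘ v -> u = v.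
Proof. apply (kernel_mono (proj1 (pt_exact X))). Qed.

Lemma pt_r_epi (X W : C) (u v : Hom (fpart X) W) : u ∘ pt_r X = v ∘ pt_r X -> u = v.
Proof. apply (cokernel_epi (proj2 (pt_exact X))). Qed.

Definition Gamma :
  Functor C (ProdCat (FullSub (@torsion C)) (FullSub (@torsionfree C))).
Proof.
refine (@Build_Functor C (ProdCat (FullSub (@torsion C)) (FullSub (@torsionfree C)))
  (fun X => ⟨exist _ (tpart X) (tpart_torsion X), exist _ (fpart X) (fpart_torsionfree X)⟩)
  (fun X Y h => ⟨tmap h, ffmap h⟩) _ _).
- abstract (intros; simpl; f_equal;
    [apply pt_l_mono; now rewrite tmapE, comp_idl, comp_idr
    |apply pt_r_epi; now rewrite ffmapE, comp_idl, comp_idr]).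
- abstract (intros; simpl; f_equal;
    [apply pt_l_mono; now rewrite tmapE, <- comp_assoc, tmapE, !comp_assoc, tmapE
    |apply pt_r_epi; now rewrite ffmapE, comp_assoc, ffmapE, <- !comp_assoc, ffmapE]).
Defined.

End Induced.

Record RectTorsionTheory := {
  rt_pt :> PretorsionTheory;
  rt_rectangular : is_equivalence (Gamma rt_pt);
  rt_pointed : exists Z : rt_pt, is_zero Z;
  rt_trivial : forall X : rt_pt, trivial_object X <-> is_zero X }.

Definition torsion_functor (C D : PretorsionTheory) (F : FunCat C D) : Prop :=
  (forall X : C, torsion X -> torsion (fob F X)) /\
  (forall X : C, torsionfree X -> torsionfree (fob F X)) /\
  (forall X : C, short_exact (@trivial_object D) (fmap F (pt_l X)) (fmap F (pt_r X))).

Lemma torsion_functor_id (C : PretorsionTheory) : torsion_functor (IdF C).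
Proof. split; [|split]; trivial. intros X; exact (pt_exact X). Qed.

Lemma torsion_functor_comp (C D E : PretorsionTheory) (G : Functor D E)
  (F : Functor C D) :
  torsion_functor G -> torsion_functor F -> torsion_functor (CompF G F).
Proof.
intros [G1 [G2 G3]] [F1 [F2 F3]]; split; [|split]; [simpl; auto | simpl; auto |].
intros X; simpl.
pose proof (F1 _ (tpart_torsion X)) as tT; pose proof (F2 _ (fpart_torsionfree X)) as fF.
pose proof (tpart_torsion (F X)) as tT'; pose proof (fpart_torsionfree (F X)) as fF'.
destruct (F3 X) as [Hk Hc], (pt_exact (F X)) as [Hk' Hc'].
pose proof (kernel_mono Hk) as Mk; pose proof (kernel_mono Hk') as Mk'.
pose proof (cokernel_epi Hc) as Ec; pose proof (cokernel_epi Hc') as Ec'.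
destruct (proj2 Hk' _ (fmap F (pt_l X))) as [i [Hi _]]; [now apply pt_null|].
destruct (proj2 Hk _ (pt_l (F X))) as [i' [Hi' _]]; [now apply pt_null|].
destruct (proj2 Hc' _ (fmap F (pt_r X))) as [j [Hj _]]; [now apply pt_null|].
destruct (proj2 Hc _ (pt_r (F X))) as [j' [Hj' _]]; [now apply pt_null|].
rewrite <- Hi, <- Hj, !fmap_comp; apply short_exact_iso; [| |apply G3];
  apply is_iso_fmap.
- exists i'; split; [apply Mk; now rewrite <- comp_assoc, Hi', comp_idr
    |apply Mk'; now rewrite <- comp_assoc, Hi, comp_idr].
- exists j'; split; [apply Ec'; now rewrite comp_assoc, Hj, comp_idl
    |apply Ec; now rewrite comp_assoc, Hj', comp_idl].
Qed.

Definition TorR : TwoCategory :=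
  @FunTwoCat RectTorsionTheory rt_pt (fun C D => @torsion_functor C D)
    (fun C => torsion_functor_id C)
    (fun C D E G F HG HF => torsion_functor_comp HG HF).

Lemma torsion_functor_zero (C D : RectTorsionTheory) (F : Functor C D) :
  torsion_functor F -> preserves_zero F.
Proof.
intros [H1 [H2 _]] Z HZ; destruct (proj2 (rt_trivial Z) HZ) as [HT HF].
apply (rt_trivial (F Z : D)); split; auto.
Qed.

Definition rt_pointedcat (C : RectTorsionTheory) : PointedCat :=
  {| pc_cat := C; pc_zero := rt_pointed C |}.

Definition TorRForgetHom (C D : RectTorsionTheory) :
  Functor (@thom TorR C D) (@thom PointCat (rt_pointedcat C) (rt_pointedcat D)).
Proof.
refine (@Build_Functor (@thom TorR C D)
  (@thom PointCat (rt_pointedcat C) (rt_pointedcat D))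
  (fun F => exist _ (proj1_sig F) (torsion_functor_zero (proj2_sig F)))
  (fun F G α => α) _ _); abstract reflexivity.
Defined.

Definition TorRForget : TwoFunctor TorR PointCat.
Proof.
refine (@Build_TwoFunctor TorR PointCat rt_pointedcat TorRForgetHom _ _ _).
- abstract (intros; apply full_eq; reflexivity).
- abstract (intros; apply full_eq; reflexivity).
- abstract (intros; apply heq_nt; [reflexivity | reflexivity | intros; constructor]).
Defined.

(* Main.v *)
From Stdlib Require Import ClassicalEpsilon FunctionalExtensionality
  ProofIrrelevance PropExtensionality.
Require Import Defs.

Set Implicit Arguments.
Unset Strict Implicit.
Unset Printing Implicit Defensive.

Local Open Scope cat_scope.

(** Both kinds of structure on a pointed category [C] amount to the same datum: a pair
    of natural idempotents [e1], [e2] of the identity functor, with [e1 ∘ e2 = 0],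
    along which [C] is a product of two categories. That datum is called a
    [Decomposition] here. The product is expressed by mixtures: a mixture of [X] and
    [Y] is an object that has the [e1]-part of [X] and the [e2]-part of [Y], namely a
    pair [p : M -> X], [q : M -> Y] such that maps into [M] are pairs of a map into [X]
    fixed by [e1] and a map into [Y] fixed by [e2]. All pairs must have a mixture, and
    each object must be a mixture of itself with itself.

    For a rectangular torsion theory, [e1] is the endomorphism that [Gamma] sends to
    [(1, 0)] and [e2] the one sent to [(0, 1)]; mixtures exist because [Gamma] is
    essentially surjective ([torsion_dec]). Conversely the objects with [e1 = 1] and
    those with [e2 = 1] form a rectangular torsion theory, in which the torsion part of
    [X] is the mixture of [X] with a zero object ([dec_torsion]). A functor is a 1-cell
    of torsion theories exactly if it commutes with the idempotents
    ([respects_torsion_functor], [torsion_functor_respects]).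

    For a pseudo-algebra with action [m], conjugating [m(1, 0)] and [m(0, 1)] with the
    unit [X -> m(X, X)] gives [e1] and [e2], and [m(X, Y)] is a mixture of [X] and [Y]
    ([act_mix], [alg_dec]). Conversely a choice of mixtures is a functor
    [C × C -> C]; its unit and multiplication are the maps between mixtures given by
    the universal property, and the coherence laws hold because the two projections of
    a mixture are jointly monic ([dec_alg]). The same joint monicity shows that a
    pseudo-morphism has no freedom beyond its underlying functor ([psmor_unique]), that
    this functor may be any zero-preserving one that commutes with the idempotents
    ([psmor_respects], [lift]), and that every natural transformation is a 2-cell
    ([is_alg_cell_of_nt]).

    So over each functor of pointed categories there is at most one 1-cell on either
    side, with the same existence condition, and the 2-cells agree. Passing from a
    decomposition to a torsion theory or to a pseudo-algebra and back returns the same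
    idempotents ([dec_torsionK], [dec_algK]); hence the unit and counit of the
    2-equivalence are carried by identity functors. *)

(** * Zero morphisms *)

Lemma null_unique (C : Category) (X Y : C) (f g : Hom X Y) :
  null (@is_zero C) f -> null (@is_zero C) g -> f = g.
Proof.
intros [V [[_ HV] [a [b ->]]]] [W [[HW _] [c [d ->]]]].
destruct (HV W) as [z _].
destruct (HV Y) as [bY Hb]; rewrite (Hb b), <- (Hb (d ∘ z)), comp_assoc; f_equal.
destruct (HW X) as [xW Hx]; now rewrite (Hx c), (Hx (z ∘ a)).
Qed.

Lemma zmor_ex (C : PointedCat) (X Y : C) :
  exists f : Hom X Y, null (@is_zero C) f.
Proof.
destruct (pc_zero C) as [Z HZ].
destruct (proj1 HZ X) as [f _], (proj2 HZ Y) as [g _].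
exists (g ∘ f), Z; split; [exact HZ|]; now exists f, g.
Qed.

Definition zmor (C : PointedCat) (X Y : C) : Hom X Y :=
  proj1_sig (constructive_indefinite_description _ (zmor_ex X Y)).
Arguments zmor {C X Y}.

Section ZeroMorphisms.

Context (C : PointedCat).
Implicit Types X Y W : C.

Lemma null_zmor X Y : null (@is_zero C) (@zmor C X Y).
Proof. exact (proj2_sig (constructive_indefinite_description _ (zmor_ex X Y))). Qed.

Lemma zmorP X Y (f : Hom X Y) : null (@is_zero C) f <-> f = zmor.
Proof.
split; [intros H; apply (null_unique H), null_zmor | intros ->; apply null_zmor].
Qed.

Lemma zmorl X Y W (f : Hom X Y) : @zmor C Y W ∘ f = zmor.
Proof. apply zmorP, null_compr, null_zmor. Qed.

Lemma zmorr X Y W (f : Hom Y W) : f ∘ @zmor C X Y = zmor.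
Proof. apply zmorP, null_compl, null_zmor. Qed.

Lemma is_zero_idm X : is_zero X <-> idm X = zmor.
Proof.
split.
- intros [H _]; destruct (H X) as [f Hf]; now rewrite (Hf (idm X)), (Hf zmor).
- intros H; split; intros Y; exists zmor; intros g.
  + now rewrite <- (comp_idl g), H, zmorl.
  + now rewrite <- (comp_idr g), H, zmorr.
Qed.

End ZeroMorphisms.

Lemma fmap_zmor (C D : PointedCat) (F : Functor C D) (X Y : C) :
  preserves_zero F -> fmap F (@zmor C X Y) = zmor.
Proof.
intros HF; apply zmorP; destruct (null_zmor X Y) as [Z [HZ [a [b ->]]]].
exists (F Z); split; [now apply HF|]; exists (fmap F a), (fmap F b); apply fmap_comp.
Qed.

(** * Decompositions of a pointed category *)

Section Mixtures.

Context (C : Category) (e1 e2 : forall X : C, Hom X X).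

(** In the idempotent completion, [M] is the product of the image of [e1 X] and the
    image of [e2 Y]. The bound maps [a] and [b] are arbitrary and enter only through
    [e1 X ∘ a] and [e2 Y ∘ b], so that no splitting of the idempotents is needed. *)
Definition is_mix (X Y M : C) (p : Hom M X) (q : Hom M Y) : Prop :=
  e1 X ∘ p = p /\ e2 Y ∘ q = q /\
  forall (W : C) (a : Hom W X) (b : Hom W Y),
    exists! g : Hom W M, p ∘ g = e1 X ∘ a /\ q ∘ g = e2 Y ∘ b.

Lemma is_mix_mono (X Y M : C) (p : Hom M X) (q : Hom M Y) : is_mix p q ->
  forall (W : C) (g h : Hom W M), p ∘ g = p ∘ h -> q ∘ g = q ∘ h -> g = h.
Proof.
intros [Hp [Hq H]] W g h E1 E2.
(* [p ∘ g] and [q ∘ g] are already fixed by the idempotents. *)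
destruct (H W (p ∘ g) (q ∘ g)) as [k [_ Hk]].
rewrite <- (Hk g), <- (Hk h); trivial; now rewrite <- !comp_assoc, Hp, Hq.
Qed.

Lemma is_mix_precomp_iso (X Y M N : C) (p : Hom M X) (q : Hom M Y) (k : Hom N M) :
  is_iso k -> is_mix p q -> is_mix (p ∘ k) (q ∘ k).
Proof.
intros [k' [Hk Hk']] Hm; pose proof (is_mix_mono Hm) as mono.
destruct Hm as [Hp [Hq H]]; split; [|split].
- now rewrite <- comp_assoc, Hp.
- now rewrite <- comp_assoc, Hq.
- intros W a b; destruct (H W a b) as [g [[Ea Eb] _]].
  assert (E : k ∘ (k' ∘ g) = g) by now rewrite <- comp_assoc, Hk', comp_idl.
  exists (k' ∘ g); split.
  + now rewrite !comp_assoc, E.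
  + intros h [Ha Hb].
    rewrite (mono W g (k ∘ h)), <- comp_assoc, Hk, comp_idl; trivial;
      rewrite <- comp_assoc; [now rewrite Ea, Ha | now rewrite Eb, Hb].
Qed.

End Mixtures.

(** [C] seen as a product of two categories: [e1] is the endomorphism [(1, 0)] and [e2]
    the endomorphism [(0, 1)]. On arrows, [mix_self] says that a map is a pair of an
    [e1]-component and an [e2]-component; on objects, [mix_ex] says that the components
    of two objects can be recombined. *)
Record Decomposition (C : PointedCat) := {
  e1 : forall X : C, Hom X X;
  e2 : forall X : C, Hom X X;
  e1_nat : forall (X Y : C) (f : Hom X Y), e1 Y ∘ f = f ∘ e1 X;
  e2_nat : forall (X Y : C) (f : Hom X Y), e2 Y ∘ f = f ∘ e2 X;
  e1_e2 : forall X, e1 X ∘ e2 X = zmor;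
  mix_self : forall X, is_mix e1 e2 (e1 X) (e2 X);
  mix_ex : forall X Y : C, exists (M : C) (p : Hom M X) (q : Hom M Y),
    is_mix e1 e2 p q }.

Section Decomposition.

Context (C : PointedCat) (D : Decomposition C).
Local Notation e1 := (e1 D).
Local Notation e2 := (e2 D).
Local Notation is_mix := (is_mix e1 e2).
Implicit Types X Y Z W M N L : C.

Lemma e1_e1 X : e1 X ∘ e1 X = e1 X.
Proof. apply (mix_self D X). Qed.

Lemma e2_e2 X : e2 X ∘ e2 X = e2 X.
Proof. apply (mix_self D X). Qed.

Lemma e2_e1 X : e2 X ∘ e1 X = zmor.
Proof. now rewrite e2_nat, e1_e2. Qed.

Lemma e2_mixl X Y M (p : Hom M X) (q : Hom M Y) : is_mix p q -> e2 X ∘ p = zmor.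
Proof. intros [<- _]; now rewrite <- comp_assoc, e2_e1, zmorl. Qed.

Lemma e1_mixr X Y M (p : Hom M X) (q : Hom M Y) : is_mix p q -> e1 Y ∘ q = zmor.
Proof. intros [_ [<- _]]; now rewrite <- comp_assoc, e1_e2, zmorl. Qed.

Lemma is_mix_compare_iso X Y M N (p : Hom M X) (q : Hom M Y) (r : Hom N X) (s : Hom N Y)
  (k : Hom M N) : is_mix p q -> is_mix r s -> r ∘ k = p -> s ∘ k = q -> is_iso k.
Proof.
intros Hm Hn Hr Hs; pose proof Hm as [_ [_ H]]; pose proof Hn as [Er [Es _]].
destruct (H N r s) as [k' [[Ep Eq] _]]; rewrite Er in Ep; rewrite Es in Eq.
exists k'; split; [apply (is_mix_mono Hm) | apply (is_mix_mono Hn)];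
  rewrite comp_idr, <- comp_assoc; congruence.
Qed.

(** The [e1]-part of [L] is that of [M], which is that of [X]; dually for [e2]. To
    lift a map along [p], pair it with a zero map. This gives the multiplication of
    the pseudo-algebra of mixtures. *)
Lemma is_mix_comp X Y Z W M N L (p : Hom M X) (q : Hom M Y) (r : Hom N Z)
  (s : Hom N W) (t : Hom L M) (v : Hom L N) :
  is_mix p q -> is_mix r s -> is_mix t v -> is_mix (p ∘ t) (s ∘ v).
Proof.
intros Hpq Hrs Htv; pose proof Hpq as [Ep [_ Upq]]; pose proof Hrs as [_ [Es Urs]].
pose proof Htv as [Et [Ev Utv]]; split; [|split].
- now rewrite <- comp_assoc, Ep.
- now rewrite <- comp_assoc, Es.
- intros V a b.
  destruct (Upq V a zmor) as [a' [[Ea _] _]], (Urs V zmor b) as [b' [[_ Eb] _]].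
  destruct (Utv V a' b') as [g [[Eg Eg'] _]]; exists g; split; [split|].
  + now rewrite comp_assoc, Eg, <- comp_assoc, <- e1_nat, Ep.
  + now rewrite comp_assoc, Eg', <- comp_assoc, <- e2_nat, Es.
  + intros h [Ha Hb]; apply (is_mix_mono Htv).
    * apply (is_mix_mono Hpq); rewrite <- !comp_assoc.
      -- rewrite Ha, comp_assoc, Eg, <- comp_assoc, <- e1_nat, Ep; exact Ea.
      -- rewrite <- Et, <- !comp_assoc, <- e1_nat, (e1_mixr Hpq); now rewrite !zmorl.
    * apply (is_mix_mono Hrs); rewrite <- !comp_assoc.
      -- rewrite <- Ev, <- !comp_assoc, <- e2_nat, (e2_mixl Hrs); now rewrite !zmorl.
      -- rewrite Hb, comp_assoc, Eg', <- comp_assoc, <- e2_nat, Es; exact Eb.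
Qed.

(** Together with [is_mix_of_sections], an equational form of the universal property,
    which functors preserve: [p] is an isomorphism as far as [e1] is concerned, and [q]
    as far as [e2] is. *)
Lemma is_mix_sections X Y M (p : Hom M X) (q : Hom M Y) : is_mix p q ->
  exists (p' : Hom X M) (q' : Hom Y M),
    p ∘ p' = e1 X /\ p' ∘ p = e1 M /\ q ∘ q' = e2 Y /\ q' ∘ q = e2 M.
Proof.
intros Hm; pose proof Hm as [Ep [Eq H]].
destruct (H X (idm X) zmor) as [p' [[H1 H2] _]].
destruct (H Y zmor (idm Y)) as [q' [[H3 H4] _]].
rewrite comp_idr in H1, H4; rewrite zmorr in H2, H3.
exists p', q'; repeat split; trivial; apply (is_mix_mono Hm); rewrite <- comp_assoc.
- now rewrite H1, <- e1_nat.
- now rewrite H2, <- e1_nat, (e1_mixr Hm), zmorl.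
- now rewrite H3, <- e2_nat, (e2_mixl Hm), zmorl.
- now rewrite H4, <- e2_nat.
Qed.

Lemma is_mix_of_sections X Y M (p : Hom M X) (q : Hom M Y) (p' : Hom X M) (q' : Hom Y M) :
  e1 X ∘ p = p -> e2 Y ∘ q = q ->
  p ∘ p' = e1 X -> p' ∘ p = e1 M -> q ∘ q' = e2 Y -> q' ∘ q = e2 M -> is_mix p q.
Proof.
intros Ep Eq H1 H2 H3 H4; split; [|split]; trivial; intros W a b.
destruct (mix_self D M) as [_ [_ H]].
destruct (H W (p' ∘ a) (q' ∘ b)) as [g [[Ea Eb] U]]; exists g; split; [split|].
- rewrite <- Ep at 1; rewrite e1_nat, comp_assoc, Ea, <- !comp_assoc, <- e1_nat.
  now rewrite Ep, H1.
- rewrite <- Eq at 1; rewrite e2_nat, comp_assoc, Eb, <- !comp_assoc, <- e2_nat.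
  now rewrite Eq, H3.
- intros h [Ha Hb]; apply U; split.
  + now rewrite <- H2 at 1; rewrite comp_assoc, Ha, <- !comp_assoc, e1_nat.
  + now rewrite <- H4 at 1; rewrite comp_assoc, Hb, <- !comp_assoc, e2_nat.
Qed.

Lemma e12_mono X Y (f g : Hom X Y) :
  e1 Y ∘ f = e1 Y ∘ g -> e2 Y ∘ f = e2 Y ∘ g -> f = g.
Proof. apply (is_mix_mono (mix_self D Y)). Qed.

Lemma is_zero_e12 X : is_zero X <-> e1 X = idm X /\ e2 X = idm X.
Proof.
rewrite is_zero_idm; split.
- intros H; split; rewrite H, <- (comp_idl zmor); [rewrite <- (comp_idl (e1 X))
    | rewrite <- (comp_idl (e2 X))]; now rewrite H, !zmorl.
- intros [H K]; rewrite <- (e1_e2 D X), H, K; now rewrite comp_idl.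
Qed.

End Decomposition.

Definition respects (C C' : PointedCat) (D : Decomposition C) (D' : Decomposition C')
  (F : Functor C C') : Prop :=
  forall X : C, fmap F (e1 D X) = e1 D' (F X) /\ fmap F (e2 D X) = e2 D' (F X).

Lemma is_mix_image (C C' : PointedCat) (D : Decomposition C) (D' : Decomposition C')
  (F : Functor C C') (X Y M : C) (p : Hom M X) (q : Hom M Y) :
  respects D D' F -> is_mix (e1 D) (e2 D) p q ->
  is_mix (e1 D') (e2 D') (fmap F p) (fmap F q).
Proof.
intros HF Hm; destruct (is_mix_sections Hm) as [p' [q' [H1 [H2 [H3 H4]]]]].
destruct Hm as [Ep [Eq _]].
apply (@is_mix_of_sections _ _ _ _ _ _ _ (fmap F p') (fmap F q'));
  rewrite <- ?(proj1 (HF _)), <- ?(proj2 (HF _)), <- fmap_comp; congruence.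
Qed.

(** * Exactness of split sequences *)

Section SplitSequences.

Context (C : PointedCat) (D : Decomposition C).

(** If [r ∘ u] is null then [e2 X ∘ u = r' ∘ r ∘ u] vanishes, so [u] equals
    [e1 X ∘ u] and factors through [l]; dually for the cokernel. *)
Lemma split_seq_exact (A X B : C) (l : Hom A X) (r : Hom X B) (l' : Hom X A)
  (r' : Hom B X) :
  l ∘ l' = e1 D X -> l' ∘ l = idm A -> r' ∘ r = e2 D X -> r ∘ r' = idm B ->
  short_exact (@is_zero C) l r.
Proof.
intros H1 H2 H3 H4.
assert (N : r ∘ l = zmor).
{ rewrite <- (comp_idl r), <- H4, <- (comp_idr l), <- H2.
  rewrite !comp_assoc, <- (comp_assoc l), H1, <- (comp_assoc r' r), H3.
  now rewrite <- (comp_assoc (e2 D X)), e2_e1, zmorl, zmorr. }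
split; split; try now apply zmorP.
- intros W u Hu; apply zmorP in Hu; exists (l' ∘ u); split.
  + rewrite <- comp_assoc, H1; apply (e12_mono (D := D)).
    * now rewrite <- comp_assoc, e1_e1.
    * rewrite <- comp_assoc, e2_e1, <- H3, comp_assoc, Hu; now rewrite zmorl, zmorr.
  + intros v <-; now rewrite <- comp_assoc, H2, comp_idl.
- intros W u Hu; apply zmorP in Hu; exists (u ∘ r'); split.
  + rewrite comp_assoc, H3; apply (e12_mono (D := D)).
    * rewrite !e1_nat, comp_assoc, e2_e1, <- H1, <- comp_assoc, Hu.
      now rewrite zmorl, zmorr.
    * now rewrite !e2_nat, comp_assoc, e2_e2.
  + intros v <-; now rewrite comp_assoc, H4, comp_idr.
Qed.

End SplitSequences.

(** * Equivalences of categories *)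

Lemma nt_is_iso (C D : Category) (F G : Functor C D) (α : NatTrans F G) :
  (forall X, is_iso (α X)) -> @is_iso (FunCat C D) F G α.
Proof.
intros H; set (i X := constructive_indefinite_description _ (H X)).
assert (N : forall X Y (f : Hom X Y),
  proj1_sig (i Y) ∘ fmap G f = fmap F f ∘ proj1_sig (i X)).
{ intros X Y f; destruct (i X) as [a [Ka Ha]], (i Y) as [b [Hb Kb]]; simpl.
  rewrite <- (comp_idr (fmap G f)), <- Ha, <- (comp_assoc (fmap G f)), <- nt_nat.
  now rewrite <- !comp_assoc, Hb, comp_idl. }
exists {| nt_app := fun X => proj1_sig (i X); nt_nat := N |}.
split; apply nt_ext; intros X; simpl; now destruct (i X).
Qed.

Lemma nt_iso_app (C D : Category) (F G : Functor C D) (α : NatTrans F G) :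
  @is_iso (FunCat C D) F G α -> forall X, is_iso (α X).
Proof.
intros [β [H K]] X; exists (nt_app β X); split.
- exact (f_equal (fun σ : NatTrans F F => σ X) H).
- exact (f_equal (fun σ : NatTrans G G => σ X) K).
Qed.

Definition fully_faithful (C D : Category) (F : Functor C D) : Prop :=
  forall (X Y : C) (g : Hom (F X) (F Y)), exists! f : Hom X Y, fmap F f = g.

Definition ess_surj (C D : Category) (F : Functor C D) : Prop :=
  forall Y : D, exists X : C, isomorphic (F X) Y.

Lemma equivalence_ess_surj (C D : Category) (F : Functor C D) :
  is_equivalence F -> ess_surj F.
Proof.
intros [G [_ [β Hβ]]] Y; exists (G Y), (nt_app β Y); exact (nt_iso_app Hβ Y).
Qed.

Lemma equivalence_fully_faithful (C D : Category) (F : Functor C D) :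
  is_equivalence F -> fully_faithful F.
Proof.
intros [G [[α Hα] [β Hβ]]].
pose proof (nt_iso_app Hα) as iα; pose proof (nt_iso_app Hβ) as iβ; clear Hα Hβ.
assert (Nα : forall X Y (f : Hom X Y), α Y ∘ f = fmap G (fmap F f) ∘ α X)
  by exact (nt_nat α).
assert (Nβ : forall X Y (f : Hom X Y), β Y ∘ fmap F (fmap G f) = f ∘ β X)
  by exact (nt_nat β).
destruct α as [α Hα], β as [β Hβ]; simpl in *; clear Hα Hβ.
assert (faithF : forall X Y (f g : Hom X Y), fmap F f = fmap F g -> f = g).
{ intros X Y f g E; destruct (iα Y) as [a [Ha _]].
  rewrite <- (comp_idl f), <- (comp_idl g), <- Ha, !comp_assoc, !Nα; now rewrite E. }
assert (faithG : forall X Y (f g : Hom X Y), fmap G f = fmap G g -> f = g).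
{ intros X Y f g E; destruct (iβ X) as [b [_ Hb]].
  rewrite <- (comp_idr f), <- (comp_idr g), <- Hb, <- !comp_assoc, <- !Nβ;
    now rewrite E. }
intros X Y g; destruct (iα X) as [b [Hb Hb']], (iα Y) as [a [Ha Ha']].
assert (E : fmap F (a ∘ fmap G g ∘ α X) = g).
{ apply faithG.
  rewrite <- (comp_idr (fmap G (fmap F _))), <- Hb', <- comp_assoc, <- Nα.
  now rewrite <- !comp_assoc, Ha', comp_idl, comp_assoc, Hb', comp_idr. }
exists (a ∘ fmap G g ∘ α X); split; [exact E|].
intros f Hf; apply faithF; now rewrite E, Hf.
Qed.

Lemma is_equivalence_intro (C D : Category) (F : Functor C D) :
  fully_faithful F -> ess_surj F -> is_equivalence F.
Proof.
intros ff es.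
assert (faith : forall X Y (f g : Hom X Y), fmap F f = fmap F g -> f = g).
{ intros X Y f g E; destruct (ff X Y (fmap F f)) as [h [_ Hh]].
  now rewrite <- (Hh f), <- (Hh g). }
assert (c : forall Y, {X : C & {i : Hom (F X) Y & {j : Hom Y (F X) |
  j ∘ i = idm _ /\ i ∘ j = idm _}}}).
{ intros Y; destruct (constructive_indefinite_description _ (es Y)) as [X HX].
  apply constructive_indefinite_description in HX; destruct HX as [i Hi].
  exists X, i; now apply constructive_indefinite_description. }
set (G Y := projT1 (c Y)); set (b Y := projT1 (projT2 (c Y)) : Hom (F (G Y)) Y).
set (b' Y := proj1_sig (projT2 (projT2 (c Y))) : Hom Y (F (G Y))).
assert (Hb : forall Y, b' Y ∘ b Y = idm _)
  by (intros Y; apply (proj2_sig (projT2 (projT2 (c Y))))).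
assert (Hb' : forall Y, b Y ∘ b' Y = idm _)
  by (intros Y; apply (proj2_sig (projT2 (projT2 (c Y))))).
clearbody b' b; clearbody G; clear c es.
assert (full : forall X Y (g : Hom (F X) (F Y)), {f : Hom X Y | fmap F f = g}).
{ intros X Y g; apply constructive_indefinite_description.
  destruct (ff X Y g) as [f [Hf _]]; now exists f. }
set (G1 := fun X Y (g : Hom X Y) => proj1_sig (full _ _ (b' Y ∘ g ∘ b X))).
assert (HG : forall X Y (g : Hom X Y), fmap F (G1 X Y g) = b' Y ∘ g ∘ b X)
  by (intros; apply proj2_sig).
assert (G_id : forall X, G1 X X (idm X) = idm (G X)).
{ intros X; apply faith; now rewrite HG, comp_idr, Hb, fmap_id. }
assert (G_comp : forall X Y Z (g : Hom Y Z) (f : Hom X Y),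
  G1 X Z (g ∘ f) = G1 Y Z g ∘ G1 X Y f).
{ intros X Y Z g f; apply faith; rewrite fmap_comp, !HG, !comp_assoc; do 2 f_equal.
  now rewrite <- (comp_assoc (b Y)), Hb', comp_idl. }
set (GF := {| fob := G; fmap := G1; fmap_id := G_id; fmap_comp := G_comp |}).
set (a X := proj1_sig (full X (G (F X)) (b' (F X)))).
assert (Ha : forall X, fmap F (a X) = b' (F X)) by (intros; apply proj2_sig).
exists GF; split.
- assert (N : forall X Y (f : Hom X Y),
    a Y ∘ fmap (IdF C) f = fmap (CompF GF F) f ∘ a X).
  { intros X Y f; apply faith; simpl; rewrite !fmap_comp, HG, !Ha, comp_assoc.
    now rewrite Hb', comp_idr. }
  exists (@Build_NatTrans C C (IdF C) (CompF GF F) a N).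
  apply nt_is_iso; intros X; simpl.
  exists (proj1_sig (full (G (F X)) X (b (F X)))).
  destruct (full (G (F X)) X (b (F X))) as [c Hc]; simpl.
  split; apply faith; now rewrite fmap_comp, Hc, Ha, fmap_id.
- assert (N : forall X Y (f : Hom X Y),
    b Y ∘ fmap (CompF F GF) f = fmap (IdF D) f ∘ b X).
  { intros X Y f; simpl; rewrite HG, <- !comp_assoc; now rewrite Hb', comp_idl. }
  exists (@Build_NatTrans D D (CompF F GF) (IdF D) b N).
  apply nt_is_iso; intros X; simpl; now exists (b' X).
Qed.

(** * The decomposition of a rectangular torsion theory *)

Section FromTorsion.

Context (C : RectTorsionTheory).
Local Notation P := (rt_pointedcat C).

Lemma trivial_is_zero :
  (fun Z : C => torsion Z /\ torsionfree Z) = @is_zero C.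
Proof.
apply functional_extensionality; intros Z; apply propositional_extensionality.
apply (rt_trivial Z).
Qed.

Lemma rt_exact (X : C) : short_exact (@is_zero C) (pt_l X) (pt_r X).
Proof. rewrite <- trivial_is_zero; apply pt_exact. Qed.

Lemma rt_zmor (X Y : C) (f : Hom X Y) : torsion X -> torsionfree Y -> f = @zmor P X Y.
Proof.
intros HX HY; apply (zmorP (C := P)).
change (null (@is_zero C) f); rewrite <- trivial_is_zero; now apply pt_null.
Qed.

(** Full faithfulness of [Gamma] in terms of the chosen sequences: a map is freely and
    uniquely prescribed by its effect on torsion and torsion-free parts. *)
Lemma rt_glue (X Y : C) (a : Hom (tpart X) (tpart Y)) (b : Hom (fpart X) (fpart Y)) :
  exists! h : Hom X Y, h ∘ pt_l X = pt_l Y ∘ a /\ pt_r Y ∘ h = b ∘ pt_r X.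
Proof.
destruct (equivalence_fully_faithful (rt_rectangular C)
  (⟨a, b⟩ : Hom (Gamma C X) (Gamma C Y))) as [h [Hh U]].
exists h; split.
- rewrite <- tmapE, <- ffmapE; split; f_equal.
  + exact (f_equal (@pr1 _ _) Hh).
  + exact (f_equal (@pr2 _ _) Hh).
- intros k [Hk Hk']; apply U; simpl; f_equal.
  + apply pt_l_mono; now rewrite tmapE.
  + apply pt_r_epi; now rewrite ffmapE.
Qed.

Lemma rt_ext (X Y : C) (f g : Hom X Y) :
  f ∘ pt_l X = g ∘ pt_l X -> pt_r Y ∘ f = pt_r Y ∘ g -> f = g.
Proof.
intros E1 E2; destruct (rt_glue (tmap f) (ffmap f)) as [h [_ U]].
rewrite <- (U f), <- (U g); trivial; now rewrite tmapE, ffmapE.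
Qed.

Lemma rt_eso (T F : C) : torsion T -> torsionfree F ->
  exists (M : C) (i : Hom (tpart M) T) (j : Hom (fpart M) F), is_iso i /\ is_iso j.
Proof.
intros HT HF; destruct (equivalence_ess_surj (rt_rectangular C)
  ⟨exist _ T HT, exist _ F HF⟩) as [M [[i j] [[i' j'] [H K]]]].
exists M, i, j; split; [exists i' | exists j']; split;
  [exact (f_equal (@pr1 _ _) H) | exact (f_equal (@pr1 _ _) K)
  |exact (f_equal (@pr2 _ _) H) | exact (f_equal (@pr2 _ _) K)].
Qed.

Local Notation z := (@zmor P _ _).

Lemma rt_zmorl (X Y W : C) (f : Hom X Y) : (z : Hom Y W) ∘ f = z.
Proof. exact (@zmorl P X Y W f). Qed.

Lemma rt_zmorr (X Y W : C) (f : Hom Y W) : f ∘ (z : Hom X Y) = z.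
Proof. exact (@zmorr P X Y W f). Qed.

Lemma tors_e1_ex (X : C) : exists h : Hom X X,
  h ∘ pt_l X = pt_l X /\ pt_r X ∘ h = z.
Proof.
destruct (rt_glue (idm (tpart X)) z) as [h [[H K] _]].
exists h; split; [now rewrite H, comp_idr | now rewrite K, rt_zmorl].
Qed.

Lemma tors_e2_ex (X : C) : exists h : Hom X X,
  h ∘ pt_l X = z /\ pt_r X ∘ h = pt_r X.
Proof.
destruct (rt_glue z (idm (fpart X))) as [h [[H K] _]].
exists h; split; [now rewrite H, rt_zmorr | now rewrite K, comp_idl].
Qed.

(** The endomorphisms with images [(1, 0)] and [(0, 1)] under [Gamma]. *)
Definition tors_e1 (X : C) : Hom X X :=
  proj1_sig (constructive_indefinite_description _ (tors_e1_ex X)).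
Definition tors_e2 (X : C) : Hom X X :=
  proj1_sig (constructive_indefinite_description _ (tors_e2_ex X)).

Lemma tors_e1_l (X : C) : tors_e1 X ∘ pt_l X = pt_l X.
Proof. unfold tors_e1; now destruct constructive_indefinite_description. Qed.
Lemma r_tors_e1 (X : C) : pt_r X ∘ tors_e1 X = z.
Proof. unfold tors_e1; now destruct constructive_indefinite_description. Qed.
Lemma tors_e2_l (X : C) : tors_e2 X ∘ pt_l X = z.
Proof. unfold tors_e2; now destruct constructive_indefinite_description. Qed.
Lemma r_tors_e2 (X : C) : pt_r X ∘ tors_e2 X = pt_r X.
Proof. unfold tors_e2; now destruct constructive_indefinite_description. Qed.

Lemma tors_e1_nat (X Y : C) (f : Hom X Y) : tors_e1 Y ∘ f = f ∘ tors_e1 X.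
Proof.
apply rt_ext.
- now rewrite !comp_assoc, tors_e1_l, <- tmapE, <- comp_assoc, tors_e1_l.
- now rewrite <- !comp_assoc, r_tors_e1, <- ffmapE, comp_assoc, r_tors_e1, rt_zmorl,
    rt_zmorr.
Qed.

Lemma tors_e2_nat (X Y : C) (f : Hom X Y) : tors_e2 Y ∘ f = f ∘ tors_e2 X.
Proof.
apply rt_ext.
- now rewrite !comp_assoc, tors_e2_l, <- tmapE, <- comp_assoc, tors_e2_l, rt_zmorl,
    rt_zmorr.
- now rewrite <- !comp_assoc, r_tors_e2, <- ffmapE, comp_assoc, r_tors_e2.
Qed.

Lemma tors_e1_e2 (X : C) : tors_e1 X ∘ tors_e2 X = z.
Proof.
apply rt_ext.
- now rewrite comp_assoc, tors_e2_l, rt_zmorl, rt_zmorr.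
- now rewrite <- comp_assoc, r_tors_e1, rt_zmorl, rt_zmorr.
Qed.

(** A map that is iso on torsion parts and zero on torsion-free parts, together with
    one of the opposite kind, exhibits a mixture. *)
Lemma tors_mix (X Y M : C) (p : Hom M X) (q : Hom M Y)
  (i : Hom (tpart M) (tpart X)) (j : Hom (fpart M) (fpart Y)) :
  is_iso i -> is_iso j ->
  p ∘ pt_l M = pt_l X ∘ i -> pt_r X ∘ p = z ->
  q ∘ pt_l M = z -> pt_r Y ∘ q = j ∘ pt_r M ->
  is_mix (C := C) tors_e1 tors_e2 p q.
Proof.
intros [i' [Hi Hi']] [j' [Hj Hj']] pl rp ql rq; split; [|split].
- apply rt_ext.
  + now rewrite comp_assoc, pl, <- comp_assoc, tors_e1_l.
  + now rewrite <- comp_assoc, r_tors_e1, rp, rt_zmorl.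
- apply rt_ext.
  + now rewrite comp_assoc, ql, rt_zmorr.
  + now rewrite <- comp_assoc, r_tors_e2.
- intros W a b.
  destruct (rt_glue (X := W) (Y := M) (i' ∘ tmap a) (j' ∘ ffmap b)) as [g [[Hl Hr] _]].
  exists g; split; [split|]; [apply rt_ext | apply rt_ext |].
  + rewrite tors_e1_nat, !comp_assoc, Hl, tors_e1_l, <- comp_assoc, pl, comp_assoc.
    now rewrite <- (comp_assoc i), Hi', comp_idl, tmapE.
  + now rewrite <- !comp_assoc, rp, r_tors_e1, !rt_zmorl.
  + rewrite tors_e2_nat, !comp_assoc, Hl, tors_e2_l, <- comp_assoc, ql;
      now rewrite rt_zmorl, rt_zmorr.
  + rewrite <- !comp_assoc, rq, r_tors_e2, comp_assoc, Hr, <- comp_assoc.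
    now rewrite <- (comp_assoc j), Hj', comp_idl, ffmapE.
  + intros h [Ha Hb]; apply rt_ext.
    * rewrite Hl, <- tmapE; f_equal.
      rewrite <- (comp_idl (tmap h)), <- Hi, comp_assoc; f_equal.
      apply pt_l_mono; rewrite <- comp_assoc, <- pl, comp_assoc, !tmapE.
      now rewrite <- comp_assoc, Ha, tors_e1_nat, comp_assoc, tors_e1_l.
    * rewrite Hr, <- (comp_idl (pt_r M ∘ h)), <- Hj, !comp_assoc; f_equal.
      now rewrite <- comp_assoc, <- rq, comp_assoc, Hb, <- comp_assoc, r_tors_e2, ffmapE.
Qed.

Lemma tors_mix_ex (X Y : C) : exists (M : C) (p : Hom M X) (q : Hom M Y),
  is_mix (C := C) tors_e1 tors_e2 p q.
Proof.
destruct (rt_eso (tpart_torsion X) (fpart_torsionfree Y))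
  as [M [i [j [Hi Hj]]]].
destruct (rt_glue i (z : Hom (fpart M) (fpart X))) as [p [[pl rp] _]].
destruct (rt_glue (z : Hom (tpart M) (tpart Y)) j) as [q [[ql rq] _]].
exists M, p, q; apply (tors_mix Hi Hj); trivial.
- now rewrite rp, rt_zmorl.
- now rewrite ql, rt_zmorr.
Qed.

Lemma tors_mix_self (X : C) : is_mix (C := C) tors_e1 tors_e2 (tors_e1 X) (tors_e2 X).
Proof.
apply (tors_mix (is_iso_idm _) (is_iso_idm _));
  rewrite ?tors_e1_l, ?r_tors_e1, ?tors_e2_l, ?r_tors_e2, ?comp_idl, ?comp_idr; trivial.
Qed.

Definition torsion_dec : Decomposition P :=
  @Build_Decomposition P tors_e1 tors_e2 tors_e1_nat tors_e2_nat tors_e1_e2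
    tors_mix_self tors_mix_ex.

Lemma tors_e1_unique (X : C) (h : Hom X X) :
  h ∘ pt_l X = pt_l X -> pt_r X ∘ h = z -> h = tors_e1 X.
Proof. intros H K; apply rt_ext; now rewrite ?tors_e1_l, ?r_tors_e1. Qed.

Lemma tors_e2_unique (X : C) (h : Hom X X) :
  h ∘ pt_l X = z -> pt_r X ∘ h = pt_r X -> h = tors_e2 X.
Proof. intros H K; apply rt_ext; now rewrite ?tors_e2_l, ?r_tors_e2. Qed.

Lemma tors_e1_factor (X : C) : exists l' : Hom X (tpart X),
  pt_l X ∘ l' = tors_e1 X /\ l' ∘ pt_l X = idm (tpart X).
Proof.
destruct (proj2 (proj1 (rt_exact X)) X (tors_e1 X)) as [l' [Hl _]].
{ apply (zmorP (C := P)), r_tors_e1. }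
exists l'; split; trivial.
apply pt_l_mono; now rewrite <- comp_assoc, Hl, tors_e1_l, comp_idr.
Qed.

Lemma tors_e2_factor (X : C) : exists r' : Hom (fpart X) X,
  r' ∘ pt_r X = tors_e2 X /\ pt_r X ∘ r' = idm (fpart X).
Proof.
destruct (proj2 (proj2 (rt_exact X)) X (tors_e2 X)) as [r' [Hr _]].
{ apply (zmorP (C := P)), tors_e2_l. }
exists r'; split; trivial.
apply pt_r_epi; now rewrite comp_assoc, Hr, r_tors_e2, comp_idl.
Qed.

(** If [X] is torsion then [pt_r X] is null by the first axiom, so the identity
    satisfies the equations of [tors_e1]. If [tors_e1] is the identity then [pt_l X] is
    an isomorphism, by [tors_e1_factor]. *)
Lemma torsionE (X : C) : torsion X <-> tors_e1 X = idm X.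
Proof.
split.
- intros HX; symmetry; apply tors_e1_unique; [apply comp_idl|].
  rewrite comp_idr; apply rt_zmor; [trivial | apply fpart_torsionfree].
- intros H; destruct (tors_e1_factor X) as [l' [H1 H2]].
  apply (@torsion_replete C (tpart X)); [|apply tpart_torsion].
  exists (pt_l X), l'; now rewrite H1, H2, H.
Qed.

Lemma torsionfreeE (X : C) : torsionfree X <-> tors_e2 X = idm X.
Proof.
split.
- intros HX; symmetry; apply tors_e2_unique; [|apply comp_idr].
  rewrite comp_idl; apply rt_zmor; [apply tpart_torsion | trivial].
- intros H; destruct (tors_e2_factor X) as [r' [H1 H2]].
  apply (@torsionfree_replete C (fpart X)); [|apply fpart_torsionfree].
  exists r', (pt_r X); now rewrite H1, H2, H.
Qed.

End FromTorsion.

(** Membership in the two subcategories is an equation between idempotents, and the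
    chosen sequences are split by sections that [F] transports. *)
Lemma respects_torsion_functor (C C' : RectTorsionTheory) (F : Functor C C') :
  respects (C := rt_pointedcat C) (C' := rt_pointedcat C')
    (torsion_dec C) (torsion_dec C') F ->
  torsion_functor F.
Proof.
intros HF; split; [|split]; intros X.
- rewrite !torsionE; intros H; rewrite <- fmap_id, <- H; symmetry; apply (HF X).
- rewrite !torsionfreeE; intros H; rewrite <- fmap_id, <- H; symmetry; apply (HF X).
- change (@trivial_object C') with (fun Z : C' => torsion Z /\ torsionfree Z).
  rewrite trivial_is_zero; destruct (tors_e1_factor X) as [l' [H1 H2]],
    (tors_e2_factor X) as [r' [H3 H4]].
  apply (@split_seq_exact (rt_pointedcat C') (torsion_dec C') _ _ _ _ _
    (fmap F l') (fmap F r')); simpl; rewrite <- fmap_comp.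
  + rewrite H1; apply (HF X).
  + now rewrite H2, fmap_id.
  + rewrite H3; apply (HF X).
  + now rewrite H4, fmap_id.
Qed.

(** As the image of the sequence of [X] is exact with torsion and torsion-free ends,
    the chosen sequence of [F X] factors through it; hence an endomorphism of [F X] is
    determined by its composites with the two maps of the image. On these, [F e1] and
    [e1] agree. *)
Lemma torsion_functor_respects (C C' : RectTorsionTheory) (F : Functor C C') :
  torsion_functor F ->
  respects (C := rt_pointedcat C) (C' := rt_pointedcat C')
    (torsion_dec C) (torsion_dec C') F.
Proof.
intros HF; pose proof (torsion_functor_zero HF) as F0.
destruct HF as [HT [HF HE]]; intros X.
assert (ext : forall f g : Hom (F X) (F X), f ∘ fmap F (pt_l X) = g ∘ fmap F (pt_l X) ->
  fmap F (pt_r X) ∘ f = fmap F (pt_r X) ∘ g -> f = g).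
{ pose proof (HE X) as [Hk Hc].
  change (@trivial_object C') with (fun Z : C' => torsion Z /\ torsionfree Z) in Hk, Hc.
  intros f g El Er; apply rt_ext.
  - destruct (proj2 Hk _ (pt_l (F X))) as [w [<- _]].
    { apply pt_null; [apply tpart_torsion | apply HF, fpart_torsionfree]. }
    now rewrite <- !comp_assoc, El.
  - destruct (proj2 Hc _ (pt_r (F X))) as [w [<- _]].
    { apply pt_null; [apply HT, tpart_torsion | apply fpart_torsionfree]. }
    now rewrite !comp_assoc, Er. }
pose proof (proj1 (torsionE _) (HT _ (tpart_torsion X))) as T1.
pose proof (proj1 (torsionfreeE _) (HF _ (fpart_torsionfree X))) as T2.
pose proof (e1_nat (torsion_dec C')) as N1; pose proof (e2_nat (torsion_dec C')) as N2.
pose proof (e2_e1 (torsion_dec C')) as N21; pose proof (e1_e2 (torsion_dec C')) as N12.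
simpl in *.
pose proof (fun X Y => @fmap_zmor (rt_pointedcat C) (rt_pointedcat C') F X Y F0) as FZ.
simpl in FZ; split; apply ext.
- rewrite <- fmap_comp, tors_e1_l, N1, T1; now rewrite comp_idr.
- rewrite <- fmap_comp, r_tors_e1, FZ, <- N1.
  rewrite <- (comp_idl (fmap F (pt_r X))), <- T2, <- comp_assoc, N12.
  now rewrite (zmorl (C := rt_pointedcat C')).
- rewrite <- fmap_comp, tors_e2_l, FZ, N2, <- (comp_idr (tors_e2 _)), <- T1, N21.
  now rewrite (zmorr (C := rt_pointedcat C')).
- rewrite <- fmap_comp, r_tors_e2, <- N2, T2; now rewrite comp_idl.
Qed.

(** * The torsion theory of a decomposition *)

Section ToTorsion.

Context (C : PointedCat) (D : Decomposition C).
Local Notation e1 := (e1 D).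
Local Notation e2 := (e2 D).

(** The torsion part of [X] is its mixture with a zero object. The case distinction
    makes the chosen sequence of a torsion object start with an identity. *)
Lemma tors_incl_ex (X : C) : exists (T : C) (l : Hom T X) (l' : Hom X T),
  l ∘ l' = e1 X /\ l' ∘ l = idm T /\ (e1 X = idm X -> heq l (idm X)).
Proof.
destruct (excluded_middle_informative (e1 X = idm X)) as [H|H].
{ exists X, (idm X), (idm X); rewrite comp_idl; repeat split; congruence || constructor. }
destruct (pc_zero C) as [Z HZ], (mix_ex D X Z) as [T [l [q Hm]]].
destruct (is_mix_sections Hm) as [l' [q' [H1 [H2 _]]]].
exists T, l, l'; repeat split; trivial; [|easy].
rewrite H2; apply (is_mix_mono Hm).
- now rewrite <- e1_nat, comp_idr; apply Hm.
- destruct (proj1 HZ T) as [f Hf]; now rewrite Hf, (Hf (q ∘ _)).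
Qed.

Lemma free_quot_ex (X : C) : exists (F : C) (r : Hom X F) (r' : Hom F X),
  r' ∘ r = e2 X /\ r ∘ r' = idm F /\ (e2 X = idm X -> heq r (idm X)).
Proof.
destruct (excluded_middle_informative (e2 X = idm X)) as [H|H].
{ exists X, (idm X), (idm X); rewrite comp_idl; repeat split; congruence || constructor. }
destruct (pc_zero C) as [Z HZ], (mix_ex D Z X) as [F [p [r' Hm]]].
destruct (is_mix_sections Hm) as [p' [r [_ [_ [H1 H2]]]]].
exists F, r, r'; repeat split; trivial; [|easy].
rewrite H2; apply (is_mix_mono Hm).
- destruct (proj1 HZ F) as [f Hf]; now rewrite Hf, (Hf (p ∘ _)).
- now rewrite <- e2_nat, comp_idr; apply Hm.
Qed.

Definition tors_ob (X : C) : C :=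
  proj1_sig (constructive_indefinite_description _ (tors_incl_ex X)).
Definition free_ob (X : C) : C :=
  proj1_sig (constructive_indefinite_description _ (free_quot_ex X)).
Definition tors_incl_sig (X : C) := constructive_indefinite_description _
  (proj2_sig (constructive_indefinite_description _ (tors_incl_ex X))).
Definition free_quot_sig (X : C) := constructive_indefinite_description _
  (proj2_sig (constructive_indefinite_description _ (free_quot_ex X))).
Definition tors_incl (X : C) : Hom (tors_ob X) X := proj1_sig (tors_incl_sig X).
Definition free_quot (X : C) : Hom X (free_ob X) := proj1_sig (free_quot_sig X).

Lemma tors_incl_split (X : C) : exists l' : Hom X (tors_ob X),
  tors_incl X ∘ l' = e1 X /\ l' ∘ tors_incl X = idm _.
Proof. destruct (proj2_sig (tors_incl_sig X)) as [l' [H [K _]]]; now exists l'. Qed.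

Lemma free_quot_split (X : C) : exists r' : Hom (free_ob X) X,
  r' ∘ free_quot X = e2 X /\ free_quot X ∘ r' = idm _.
Proof. destruct (proj2_sig (free_quot_sig X)) as [r' [H [K _]]]; now exists r'. Qed.

Lemma tors_incl_torsion (X : C) : e1 X = idm X -> heq (tors_incl X) (idm X).
Proof. destruct (proj2_sig (tors_incl_sig X)) as [l' H]; apply H. Qed.

Lemma free_quot_torsionfree (X : C) : e2 X = idm X -> heq (free_quot X) (idm X).
Proof. destruct (proj2_sig (free_quot_sig X)) as [r' H]; apply H. Qed.

Lemma e1_retract (X Y : C) (l : Hom Y X) (l' : Hom X Y) :
  l ∘ l' = e1 X -> l' ∘ l = idm Y -> e1 Y = idm Y.
Proof.
intros H K; rewrite <- (comp_idl (e1 Y)), <- K, comp_assoc, <- e1_nat, <- comp_assoc.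
now rewrite <- H, <- (comp_assoc l'), K, comp_idl.
Qed.

Lemma e2_retract (X Y : C) (r : Hom X Y) (r' : Hom Y X) :
  r' ∘ r = e2 X -> r ∘ r' = idm Y -> e2 Y = idm Y.
Proof.
intros H K; rewrite <- (comp_idl (e2 Y)), <- K, comp_assoc, <- e2_nat, <- comp_assoc.
now rewrite <- H, <- (comp_assoc r), K, comp_idl.
Qed.

Lemma e1_tors_ob (X : C) : e1 (tors_ob X) = idm _.
Proof. destruct (tors_incl_split X) as [l' [H K]]; exact (e1_retract H K). Qed.

Lemma e2_free_ob (X : C) : e2 (free_ob X) = idm _.
Proof. destruct (free_quot_split X) as [r' [H K]]; exact (e2_retract H K). Qed.

Lemma e1_replete (X Y : C) : isomorphic X Y -> e1 X = idm X -> e1 Y = idm Y.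
Proof.
intros [f [g [H K]]] E; rewrite <- (comp_idr (e1 Y)), <- K, <- comp_assoc, e1_nat, E.
now rewrite comp_idr.
Qed.

Lemma e2_replete (X Y : C) : isomorphic X Y -> e2 X = idm X -> e2 Y = idm Y.
Proof.
intros [f [g [H K]]] E; rewrite <- (comp_idr (e2 Y)), <- K, <- comp_assoc, e2_nat, E.
now rewrite comp_idr.
Qed.

Lemma trivial_zero :
  (fun Z : C => e1 Z = idm Z /\ e2 Z = idm Z) = @is_zero C.
Proof.
apply functional_extensionality; intros Z; apply propositional_extensionality.
symmetry; apply is_zero_e12.
Qed.

Lemma dec_null (X Y : C) (f : Hom X Y) : e1 X = idm X -> e2 Y = idm Y ->
  null (fun Z : C => e1 Z = idm Z /\ e2 Z = idm Z) f.
Proof.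
intros HX HY; rewrite trivial_zero; apply zmorP.
rewrite <- (comp_idr f), <- (comp_idl f), <- HX, <- HY.
now rewrite e2_nat, comp_assoc, e2_e1, zmorr.
Qed.

Lemma dec_exact (X : C) :
  short_exact (fun Z : C => e1 Z = idm Z /\ e2 Z = idm Z) (tors_incl X) (free_quot X).
Proof.
rewrite trivial_zero; destruct (tors_incl_split X) as [l' [H1 H2]],
  (free_quot_split X) as [r' [H3 H4]].
apply (@split_seq_exact C D _ _ _ _ _ l' r'); trivial.
Qed.

Definition dec_pretorsion : PretorsionTheory :=
  {| torsion_replete := e1_replete; torsionfree_replete := e2_replete;
     pt_null := dec_null; tpart_torsion := e1_tors_ob; fpart_torsionfree := e2_free_ob;
     pt_exact := dec_exact; pt_l_torsion := tors_incl_torsion;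
     pt_r_torsionfree := free_quot_torsionfree |}.

Lemma e1_tors_incl (X : C) : e1 X ∘ tors_incl X = tors_incl X.
Proof. now rewrite e1_nat, e1_tors_ob, comp_idr. Qed.

Lemma free_quot_e2 (X : C) : free_quot X ∘ e2 X = free_quot X.
Proof. now rewrite <- e2_nat, e2_free_ob, comp_idl. Qed.

Lemma free_quot_tors_incl (X : C) : free_quot X ∘ tors_incl X = zmor.
Proof.
now rewrite <- e1_tors_incl, <- free_quot_e2, comp_assoc, <- (comp_assoc (e2 X)),
  e2_e1, zmorl, zmorr.
Qed.

Lemma e2_tors_incl (X : C) : e2 X ∘ tors_incl X = zmor.
Proof. now rewrite <- e1_tors_incl, <- comp_assoc, e2_e1, zmorl. Qed.

Lemma dec_ext (X Y : C) (f g : Hom X Y) :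
  f ∘ tors_incl X = g ∘ tors_incl X -> free_quot Y ∘ f = free_quot Y ∘ g -> f = g.
Proof.
intros E1 E2; destruct (tors_incl_split X) as [l' [H _]],
  (free_quot_split Y) as [r' [K _]].
apply (e12_mono (D := D)).
- now rewrite !e1_nat, <- H, <- !comp_assoc, E1.
- now rewrite <- K, !comp_assoc, E2.
Qed.

(** Components [a] and [b] are glued in the mixture of [Y] with itself. *)
Lemma dec_fully_faithful : fully_faithful (Gamma dec_pretorsion).
Proof.
intros X Y [a b]; simpl in X, Y, a, b.
destruct (tors_incl_split X) as [lX [H1 H2]], (free_quot_split Y) as [rY [K1 K2]].
destruct (mix_self D Y) as [_ [_ U]].
destruct (U X (tors_incl Y ∘ a ∘ lX) (rY ∘ b ∘ free_quot X)) as [h [[E1 E2] _]].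
assert (Hl : h ∘ tors_incl X = tors_incl Y ∘ a).
{ apply (e12_mono (D := D)); rewrite <- !comp_assoc, ?E1, ?E2.
  - now rewrite !comp_assoc, H2, comp_idr.
  - now rewrite !comp_assoc, free_quot_tors_incl, <- !comp_assoc, e2_tors_incl, zmorl,
      zmorr. }
assert (Hr : free_quot Y ∘ h = b ∘ free_quot X).
{ now rewrite <- free_quot_e2 at 1; rewrite comp_assoc, E2, <- !comp_assoc,
    free_quot_e2, K2, comp_idl. }
exists h; split.
- simpl; f_equal.
  + apply (@pt_l_mono dec_pretorsion); now rewrite tmapE.
  + apply (@pt_r_epi dec_pretorsion); now rewrite ffmapE.
- intros k Hk; apply dec_ext.
  + rewrite Hl; refine (eq_trans _ (@tmapE dec_pretorsion _ _ k)).
    simpl; f_equal; exact (eq_sym (f_equal (@pr1 _ _) Hk)).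
  + rewrite Hr; refine (eq_trans _ (@ffmapE dec_pretorsion _ _ k)).
    simpl; f_equal; exact (eq_sym (f_equal (@pr2 _ _) Hk)).
Qed.

(** The object with torsion part [T] and torsion-free part [F] is their mixture. *)
Lemma dec_ess_surj : ess_surj (Gamma dec_pretorsion).
Proof.
intros [[T HT] [F HF]]; simpl in T, HT, F, HF.
destruct (mix_ex D T F) as [M [p [q Hm]]].
destruct (is_mix_sections Hm) as [p' [q' [H1 [H2 [H3 H4]]]]].
destruct (tors_incl_split M) as [l' [L1 L2]], (free_quot_split M) as [r' [R1 R2]].
exists M; simpl; exists ⟨p ∘ tors_incl M, q ∘ r'⟩, ⟨l' ∘ p', free_quot M ∘ q'⟩; split;
  simpl; f_equal.
- now rewrite comp_assoc, <- (comp_assoc p'), H2, e1_tors_incl.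
- now rewrite comp_assoc, <- (comp_assoc q'), H4, <- comp_assoc, free_quot_e2.
- rewrite comp_assoc, <- (comp_assoc (tors_incl M)), L1, e1_nat, <- comp_assoc, H1.
  now rewrite e1_e1.
- rewrite comp_assoc, <- (comp_assoc r'), R1, e2_nat, <- comp_assoc, H3.
  now rewrite e2_e2.
Qed.

Definition dec_torsion : RectTorsionTheory :=
  {| rt_pt := dec_pretorsion;
     rt_rectangular := is_equivalence_intro dec_fully_faithful dec_ess_surj;
     rt_pointed := pc_zero C;
     rt_trivial := fun X => iff_sym (is_zero_e12 D X) |}.

(** The given idempotents satisfy the equations that single out those of the torsion
    theory. *)
Lemma dec_torsionK : respects D (torsion_dec dec_torsion) (IdF C).
Proof.
intros X; split; simpl.
- apply (@tors_e1_unique dec_torsion); [apply e1_tors_incl|].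
  change (free_quot X ∘ e1 X = zmor).
  now rewrite <- free_quot_e2, comp_assoc, e2_e1, zmorr.
- apply (@tors_e2_unique dec_torsion); [apply e2_tors_incl | apply free_quot_e2].
Qed.

End ToTorsion.

(** * Componentwise form of pasted 2-cells *)

Lemma heq_app (A B : PointedCat) (F G F' G' : @thom PointCat A B)
  (α : Hom F G) (β : Hom F' G') :
  heq α β -> forall X : A, heq (nt_app α X) (nt_app β X).
Proof. intros []; constructor. Qed.

(** The coherence laws paste 2-cells along equations between functors that hold only
    propositionally, while the values of these functors at an object agree by
    computation. Taking [eX] to be reflexivity therefore turns a law into a plain
    equation of components; this and the next four lemmas do it in both directions. *)
Lemma paste_app (A B : PointedCat) (F G G' H : @thom PointCat A B) (e : G = G')
  (β : Hom G' H) (α : Hom F G) (X : A)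
  (eX : fob (proj1_sig G) X = fob (proj1_sig G') X) :
  nt_app (β ∘[e] α) X = nt_app β X ∘[eX] nt_app α X.
Proof. destruct e; now rewrite (proof_irrelevance _ eX eq_refl). Qed.

Lemma heq_paste_app (A B : PointedCat) (F G G' H F' H' : @thom PointCat A B) (e : G = G')
  (β : Hom G' H) (α : Hom F G) (γ : Hom F' H') :
  heq (β ∘[e] α) γ -> forall (X : A) (eX : fob (proj1_sig G) X = fob (proj1_sig G') X),
  heq (nt_app β X ∘[eX] nt_app α X) (nt_app γ X).
Proof. intros E X eX; rewrite <- (paste_app e); now apply heq_app. Qed.

Lemma heq_paste_intro (A B : PointedCat) (F G G' H F' H' : @thom PointCat A B)
  (e : G = G') (β : Hom G' H) (α : Hom F G) (γ : Hom F' H') :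
  proj1_sig F = proj1_sig F' -> proj1_sig H = proj1_sig H' ->
  (forall X : A, exists eX : fob (proj1_sig G) X = fob (proj1_sig G') X,
     heq (nt_app β X ∘[eX] nt_app α X) (nt_app γ X)) ->
  heq (β ∘[e] α) γ.
Proof.
intros EF EH E; apply heq_nt; trivial; intros X; destruct (E X) as [eX K].
now rewrite (paste_app e _ _ eX).
Qed.

Lemma heq_paste2_intro (A B : PointedCat) (F G G' H F' K K' H' : @thom PointCat A B)
  (e : G = G') (β : Hom G' H) (α : Hom F G) (e' : K = K') (δ : Hom K' H') (γ : Hom F' K) :
  proj1_sig F = proj1_sig F' -> proj1_sig H = proj1_sig H' ->
  (forall X : A, exists (eX : fob (proj1_sig G) X = fob (proj1_sig G') X)
     (eX' : fob (proj1_sig K) X = fob (proj1_sig K') X),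
     heq (nt_app β X ∘[eX] nt_app α X) (nt_app δ X ∘[eX'] nt_app γ X)) ->
  heq (β ∘[e] α) (δ ∘[e'] γ).
Proof.
intros EF EH E; apply heq_paste_intro; trivial; intros X; destruct (E X) as [eX [eX' L]].
exists eX; now rewrite (paste_app e' _ _ eX').
Qed.

Lemma heq_paste3_intro (A B : PointedCat) (F G G' H F' L L' K K' H' : @thom PointCat A B)
  (e : G = G') (β : Hom G' H) (α : Hom F G) (e' : K = K') (δ : Hom K' H')
  (e'' : L = L') (γ : Hom L' K) (γ' : Hom F' L) :
  proj1_sig F = proj1_sig F' -> proj1_sig H = proj1_sig H' ->
  (forall X : A, exists (eX : fob (proj1_sig G) X = fob (proj1_sig G') X)
     (eX' : fob (proj1_sig K) X = fob (proj1_sig K') X)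
     (eX'' : fob (proj1_sig L) X = fob (proj1_sig L') X),
     heq (nt_app β X ∘[eX] nt_app α X)
       (nt_app δ X ∘[eX'] (nt_app γ X ∘[eX''] nt_app γ' X))) ->
  heq (β ∘[e] α) (δ ∘[e'] (γ ∘[e''] γ')).
Proof.
intros EF EH E; apply heq_paste2_intro; trivial.
intros X; destruct (E X) as [eX [eX' [eX'' N]]].
exists eX, eX'; now rewrite (paste_app e'' _ _ eX'').
Qed.

(** * The decomposition of a pseudo-algebra *)

Section FromAlgebra.

Context (A : PsAlgebra Mstar).
Local Notation C := (pa_car A).

Definition act : Functor (ProdCat C C) C := proj1_sig (pa_act A).
Definition act_ob (X Y : C) : C := act ⟨X, Y⟩.
Local Notation m := act_ob.
Definition act_map (X Y X' Y' : C) (f : Hom X X') (g : Hom Y Y') :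
  Hom (m X Y) (m X' Y') :=
  fmap act (A := ⟨X, Y⟩) (B := ⟨X', Y'⟩) ⟨f, g⟩.
Local Notation m1 := act_map.
Definition unit_at (X : C) : Hom X (m X X) := nt_app (pa_unit A) X.
Local Notation u := unit_at.
Definition mult_at (X Y Z W : C) : Hom (m (m X Y) (m Z W)) (m X W) :=
  nt_app (pa_mult A) ⟨⟨X, Y⟩, ⟨Z, W⟩⟩.
Arguments mult_at : clear implicits.
Local Notation mu := mult_at.

Lemma act_map_id (X Y : C) : m1 (idm X) (idm Y) = idm (m X Y).
Proof. exact (fmap_id act ⟨X, Y⟩). Qed.

Lemma act_map_comp (X Y X' Y' X'' Y'' : C) (f' : Hom X' X'') (f : Hom X X')
  (g' : Hom Y' Y'') (g : Hom Y Y') : m1 (f' ∘ f) (g' ∘ g) = m1 f' g' ∘ m1 f g.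
Proof. exact (@fmap_comp _ _ act ⟨X, Y⟩ ⟨X', Y'⟩ ⟨X'', Y''⟩ ⟨f', g'⟩ ⟨f, g⟩). Qed.

Lemma unit_at_nat (X Y : C) (f : Hom X Y) : u Y ∘ f = m1 f f ∘ u X.
Proof. exact (nt_nat (pa_unit A) f). Qed.

Lemma mult_at_nat (X Y Z W X' Y' Z' W' : C) (a : Hom X X') (b : Hom Y Y') (c : Hom Z Z')
  (d : Hom W W') : mu X' Y' Z' W' ∘ m1 (m1 a b) (m1 c d) = m1 a d ∘ mu X Y Z W.
Proof.
exact (@nt_nat _ _ _ _ (pa_mult A) ⟨⟨X, Y⟩, ⟨Z, W⟩⟩ ⟨⟨X', Y'⟩, ⟨Z', W'⟩⟩
  ⟨⟨a, b⟩, ⟨c, d⟩⟩).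
Qed.

Lemma unit_at_iso (X : C) : is_iso (u X).
Proof. exact (nt_iso_app (pa_unit_iso A) X). Qed.

Lemma mult_unit (X Y : C) : mu X Y X Y ∘ u (m X Y) = idm (m X Y).
Proof.
assert (H : mu X Y X Y ∘ m1 (m1 (idm X) (idm Y)) (m1 (idm X) (idm Y)) ∘
  (idm _ ∘ (u (m X Y) ∘ idm _)) = idm (m X Y)).
{ exact (heq_eq (@heq_paste_app (Square C) C _ _ _ _ _ _ _ _ _ _
    (pa_coh_unitl A) ⟨X, Y⟩ eq_refl)). }
now rewrite !act_map_id, comp_idl, !comp_idr in H.
Qed.

Lemma act_map_zmor (X Y X' Y' : C) : m1 (@zmor C X X') (@zmor C Y Y') = zmor.
Proof.
assert (H : @zmor (Square C) ⟨X, Y⟩ ⟨X', Y'⟩ = ⟨zmor, zmor⟩).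
{ symmetry; apply zmorP; destruct (pc_zero C) as [Z HZ].
  exists ⟨Z, Z⟩; split; [now apply is_zero_pair|].
  exists ⟨zmor, zmor⟩, ⟨zmor, zmor⟩; simpl; now rewrite !zmorl. }
exact (eq_trans (f_equal (fmap act (A := ⟨X, Y⟩) (B := ⟨X', Y'⟩)) (eq_sym H))
  (@fmap_zmor (Square C) C act ⟨X, Y⟩ ⟨X', Y'⟩ (proj2_sig (pa_act A)))).
Qed.

Definition unit_inv (X : C) : Hom (m X X) X :=
  proj1_sig (constructive_indefinite_description _ (unit_at_iso X)).
Local Notation ui := unit_inv.

Lemma unit_inv_unit (X : C) : ui X ∘ u X = idm X.
Proof. unfold ui; now destruct constructive_indefinite_description as [v [H K]]. Qed.

Lemma unit_unit_inv (X : C) : u X ∘ ui X = idm (m X X).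
Proof. unfold ui; now destruct constructive_indefinite_description as [v [H K]]. Qed.

Lemma unit_inv_nat (X Y : C) (f : Hom X Y) : ui Y ∘ m1 f f = f ∘ ui X.
Proof.
rewrite <- (comp_idr (_ ∘ _)), <- unit_unit_inv, <- comp_assoc, (comp_assoc (ui Y)),
  <- unit_at_nat.
now rewrite <- (comp_assoc (ui Y)), unit_inv_unit, comp_idl.
Qed.

(** The projections are built from zero maps: [m1 (idm X) zmor] collapses the second
    component, landing in [m X X], which the unit identifies with [X]. *)
Definition act_fst (X Y : C) : Hom (m X Y) X := ui X ∘ m1 (idm X) zmor.
Local Notation p := act_fst.
Definition act_snd (X Y : C) : Hom (m X Y) Y := ui Y ∘ m1 zmor (idm Y).
Local Notation q := act_snd.

Lemma unit_fst (X Y : C) : u X ∘ p X Y = m1 (idm X) zmor.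
Proof. unfold p; now rewrite <- comp_assoc, unit_unit_inv, comp_idl. Qed.

Lemma unit_snd (X Y : C) : u Y ∘ q X Y = m1 zmor (idm Y).
Proof. unfold q; now rewrite <- comp_assoc, unit_unit_inv, comp_idl. Qed.

Lemma act_fst_nat (X Y X' Y' : C) (f : Hom X X') (g : Hom Y Y') :
  p X' Y' ∘ m1 f g = f ∘ p X Y.
Proof.
unfold p; rewrite <- comp_assoc, <- unit_inv_nat, !comp_assoc, <- !act_map_comp.
now rewrite comp_idl, comp_idr, zmorl, zmorr.
Qed.

Lemma act_snd_nat (X Y X' Y' : C) (f : Hom X X') (g : Hom Y Y') :
  q X' Y' ∘ m1 f g = g ∘ q X Y.
Proof.
unfold q; rewrite <- comp_assoc, <- unit_inv_nat, !comp_assoc, <- !act_map_comp.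
now rewrite comp_idl, comp_idr, zmorl, zmorr.
Qed.

(** [mu] is natural in its two middle arguments and its target ignores them. So the
    middle components may be replaced by zero maps until both blocks come from one map
    [m X Y -> m X X], where [mu] is inverse to the unit. *)
Lemma act_fst_mult (X Y Z W : C) : p X W ∘ mu X Y Z W = p X Y ∘ p (m X Y) (m Z W).
Proof.
assert (E : mu X X X X = ui (m X X)).
{ now rewrite <- (comp_idr (mu X X X X)), <- unit_unit_inv, <- comp_assoc, mult_unit,
    comp_idl. }
unfold p at 1; rewrite comp_assoc.
rewrite <- (mult_at_nat (idm X) (@zmor C Y X) (@zmor C Z X) (@zmor C W X)), E.
rewrite act_map_zmor, <- (zmorr _ (m1 (idm X) (@zmor C Y X))).
rewrite <- (comp_idr (m1 (idm X) (@zmor C Y X))) at 1.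
rewrite act_map_comp, <- (comp_assoc (ui (m X X))), unit_inv_nat; unfold p.
now rewrite !comp_assoc.
Qed.

Lemma act_snd_mult (X Y Z W : C) : q X W ∘ mu X Y Z W = q Z W ∘ q (m X Y) (m Z W).
Proof.
assert (E : mu W W W W = ui (m W W)).
{ now rewrite <- (comp_idr (mu W W W W)), <- unit_unit_inv, <- comp_assoc, mult_unit,
    comp_idl. }
unfold q at 1; rewrite comp_assoc.
rewrite <- (mult_at_nat (@zmor C X W) (@zmor C Y W) (@zmor C Z W) (idm W)), E.
rewrite act_map_zmor, <- (zmorr _ (m1 (@zmor C Z W) (idm W))).
rewrite <- (comp_idr (m1 (@zmor C Z W) (idm W))) at 2.
rewrite act_map_comp, <- (comp_assoc (ui (m W W))), unit_inv_nat; unfold q.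
now rewrite !comp_assoc.
Qed.

(** An arrow [k] into [m X Y] can be rebuilt from its projections: apply [m1] to them
    and multiply. That this returns [k] follows from naturality of [mu], which cancels
    the zero maps in the middle, and from [mult_unit]. *)
Lemma act_mono (X Y W : C) (g h : Hom W (m X Y)) :
  p X Y ∘ g = p X Y ∘ h -> q X Y ∘ g = q X Y ∘ h -> g = h.
Proof.
intros E1 E2.
assert (H : forall k : Hom W (m X Y),
  k = mu X X Y Y ∘ m1 (u X ∘ (p X Y ∘ k)) (u Y ∘ (q X Y ∘ k)) ∘ u W).
{ intros k; rewrite <- !comp_assoc, unit_fst, unit_snd, act_map_comp, <- comp_assoc,
    mult_at_nat.
  now rewrite act_map_id, comp_idl, comp_assoc, <- unit_at_nat, <- comp_assoc,
    mult_unit, comp_idl. }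
now rewrite (H g), (H h), E1, E2.
Qed.

Definition act_e1 (X : C) : Hom X X := p X X ∘ u X.
Definition act_e2 (X : C) : Hom X X := q X X ∘ u X.

Lemma act_e1_nat (X Y : C) (f : Hom X Y) : act_e1 Y ∘ f = f ∘ act_e1 X.
Proof.
unfold act_e1; now rewrite comp_assoc, unit_at_nat, <- comp_assoc, act_fst_nat,
  comp_assoc.
Qed.

Lemma act_e2_nat (X Y : C) (f : Hom X Y) : act_e2 Y ∘ f = f ∘ act_e2 X.
Proof.
unfold act_e2; now rewrite comp_assoc, unit_at_nat, <- comp_assoc, act_snd_nat,
  comp_assoc.
Qed.

Lemma act_e1_e2 (X : C) : act_e1 X ∘ act_e2 X = zmor.
Proof.
unfold act_e1, act_e2; rewrite comp_assoc, <- (comp_assoc (u X)), unit_snd,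
  <- comp_assoc, act_fst_nat.
now rewrite !zmorl.
Qed.

Lemma act_e1_fst (X Y : C) : act_e1 X ∘ p X Y = p X Y.
Proof. unfold act_e1; now rewrite comp_assoc, unit_fst, act_fst_nat, comp_idl. Qed.

Lemma act_e2_snd (X Y : C) : act_e2 Y ∘ q X Y = q X Y.
Proof. unfold act_e2; now rewrite comp_assoc, unit_snd, act_snd_nat, comp_idl. Qed.

Lemma act_mix (X Y : C) : is_mix act_e1 act_e2 (p X Y) (q X Y).
Proof.
split; [apply act_e1_fst | split; [apply act_e2_snd|]].
intros W a b; exists (m1 a b ∘ u W); split.
- rewrite <- !comp_assoc, act_fst_nat, act_snd_nat, act_e1_nat, act_e2_nat, !comp_assoc;
    now split.
- intros g [E1 E2]; apply act_mono; rewrite ?E1, ?E2, <- comp_assoc.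
  + rewrite act_fst_nat, act_e1_nat; apply comp_assoc.
  + rewrite act_snd_nat, act_e2_nat; apply comp_assoc.
Qed.

Lemma act_mix_self (X : C) : is_mix act_e1 act_e2 (act_e1 X) (act_e2 X).
Proof. exact (is_mix_precomp_iso (unit_at_iso X) (act_mix X X)). Qed.

Definition alg_dec : Decomposition C.
Proof.
refine (@Build_Decomposition C act_e1 act_e2 act_e1_nat act_e2_nat act_e1_e2
  act_mix_self _).
intros X Y; exists (m X Y), (p X Y), (q X Y); apply act_mix.
Defined.

End FromAlgebra.

Arguments act_ob {A} X Y.
Arguments act_fst {A} X Y.
Arguments act_snd {A} X Y.
Arguments unit_at {A} X.
Arguments unit_inv {A} X.
Arguments mult_at {A} X Y Z W.

(** * Pseudo-morphisms are functors that commute with the idempotents *)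
Section Morphisms.

Local Notation m := act_ob.
Local Notation m1 := act_map.
Local Notation u := unit_at.
Local Notation mu := mult_at.
Local Notation ui := unit_inv.
Local Notation p := act_fst.
Local Notation q := act_snd.

Context (A B : PsAlgebra Mstar).
Local Notation C := (pa_car A).
Local Notation C' := (pa_car B).

Definition psmor_functor (f : PsMorphism A B) : Functor C C' := proj1_sig (pm_cell f).

Lemma psmor_functor_zero (f : PsMorphism A B) : preserves_zero (psmor_functor f).
Proof. exact (proj2_sig (pm_cell f)). Qed.

Section Structure.

Context (f : PsMorphism A B).
Local Notation F := (psmor_functor f).

Definition str_at (X Y : C) : Hom (m (F X) (F Y)) (F (m X Y)) :=
  nt_app (pm_str f) ⟨X, Y⟩.

Lemma str_at_nat (X Y X' Y' : C) (a : Hom X X') (b : Hom Y Y') :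
  str_at X' Y' ∘ m1 (fmap F a) (fmap F b) = fmap F (m1 a b) ∘ str_at X Y.
Proof. exact (@nt_nat _ _ _ _ (pm_str f) ⟨X, Y⟩ ⟨X', Y'⟩ ⟨a, b⟩). Qed.

Lemma str_unit (X : C) : str_at X X ∘ u (F X) = fmap F (u X).
Proof.
assert (H : str_at X X ∘ m1 (fmap F (idm X)) (fmap F (idm X)) ∘
  (idm _ ∘ (u (F X) ∘ idm (F X))) = idm _ ∘ fmap F (u X)).
{ exact (heq_eq (@heq_paste_app C C' _ _ _ _ _ _ _ _ _ _ (pm_coh_unit f) X eq_refl)). }
now rewrite fmap_id, act_map_id, !comp_idl, !comp_idr in H.
Qed.

(** With [act_snd_str], this pins down the structure cell: at a diagonal pair it is
    fixed by the unit law, and the projections reduce all pairs to diagonal ones since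
    they only involve zero maps. *)
Lemma act_fst_str (X Y : C) : fmap F (p X Y) ∘ str_at X Y = p (F X) (F Y).
Proof.
assert (H : fmap F (ui X) ∘ str_at X X = ui (F X)).
{ rewrite <- (comp_idr (str_at X X)), <- unit_unit_inv, <- (comp_assoc (str_at X X)),
    str_unit.
  now rewrite <- comp_assoc, <- fmap_comp, unit_inv_unit, fmap_id, comp_idl. }
unfold p; rewrite fmap_comp, comp_assoc, <- str_at_nat, <- comp_assoc, H, fmap_id.
now rewrite (fmap_zmor _ _ (psmor_functor_zero f)).
Qed.

Lemma act_snd_str (X Y : C) : fmap F (q X Y) ∘ str_at X Y = q (F X) (F Y).
Proof.
assert (H : fmap F (ui Y) ∘ str_at Y Y = ui (F Y)).
{ rewrite <- (comp_idr (str_at Y Y)), <- unit_unit_inv, <- (comp_assoc (str_at Y Y)),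
    str_unit.
  now rewrite <- comp_assoc, <- fmap_comp, unit_inv_unit, fmap_id, comp_idl. }
unfold q; rewrite fmap_comp, comp_assoc, <- str_at_nat, <- comp_assoc, H, fmap_id.
now rewrite (fmap_zmor _ _ (psmor_functor_zero f)).
Qed.

Lemma psmor_respects : respects (alg_dec A) (alg_dec B) F.
Proof.
intros X; simpl; unfold act_e1, act_e2; rewrite !fmap_comp, <- str_unit, <- !comp_assoc.
now rewrite act_fst_str, act_snd_str.
Qed.

End Structure.

Lemma act_mix_image (F : Functor C C') (X Y : C) : respects (alg_dec A) (alg_dec B) F ->
  is_mix (@act_e1 B) (@act_e2 B) (fmap F (p X Y)) (fmap F (q X Y)).
Proof. intros H; exact (is_mix_image H (act_mix X Y)). Qed.

(** The projections are natural and the structure cells commute with them, so both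
    sides have the same composites with the image of the projections. *)
Lemma is_alg_cell_of_nt (f g : PsMorphism A B) (σ : Hom (pm_cell f) (pm_cell g)) :
  is_alg_cell σ.
Proof.
apply nt_ext; intros [X Y].
pose (σ' := nt_app σ : forall Z, Hom (psmor_functor f Z) (psmor_functor g Z)).
assert (N : forall Z W (h : Hom Z W),
  fmap (psmor_functor g) h ∘ σ' Z = σ' W ∘ fmap (psmor_functor f) h)
  by (intros; symmetry; apply (nt_nat σ)).
assert (H : str_at g X Y ∘ (idm _ ∘ m1 (σ' X) (σ' Y)) =
  σ' (m X Y) ∘ fmap (psmor_functor f) (idm (m X Y)) ∘ str_at f X Y); [|exact H].
rewrite comp_idl, fmap_id, comp_idr.
apply (is_mix_mono (act_mix_image X Y (psmor_respects g))); rewrite <- !comp_assoc, N.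
- now rewrite act_fst_str, act_fst_nat, comp_assoc, act_fst_str.
- now rewrite act_snd_str, act_snd_nat, comp_assoc, act_snd_str.
Qed.

Lemma psmor_unique (f g : PsMorphism A B) : pm_cell f = pm_cell g -> f = g.
Proof.
intros E; apply psmor_ext; [exact E|].
assert (H : forall X Y (s s' :
  Hom (m (psmor_functor f X) (psmor_functor f Y)) (psmor_functor f (m X Y))),
  fmap (psmor_functor f) (p X Y) ∘ s = fmap (psmor_functor f) (p X Y) ∘ s' ->
  fmap (psmor_functor f) (q X Y) ∘ s = fmap (psmor_functor f) (q X Y) ∘ s' -> s = s')
  by (intros; now apply (is_mix_mono (act_mix_image X Y (psmor_respects f)))).
pose proof (act_fst_str f) as pf; pose proof (act_snd_str f) as qf.
pose proof (act_fst_str g) as pg; pose proof (act_snd_str g) as qg.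
unfold psmor_functor, str_at in *; destruct f, g; simpl in *; destruct E.
apply heq_of_eq, nt_ext; intros [X Y]; apply H; simpl.
- exact (eq_trans (pf X Y) (eq_sym (pg X Y))).
- exact (eq_trans (qf X Y) (eq_sym (qg X Y))).
Qed.

(** The comparison of the mixture [m (F X) (F Y)] with the image under [F] of the
    mixture [m X Y], which is again one by [is_mix_image]. *)
Section Lift.

Context (F : Functor C C') (F0 : preserves_zero F).
Context (HF : respects (alg_dec A) (alg_dec B) F).
Let cell : @thom PointCat C C' := exist _ F F0.

Lemma lift_str_ex (X Y : C) : exists s : Hom (m (F X) (F Y)) (F (m X Y)),
  fmap F (p X Y) ∘ s = p (F X) (F Y) /\ fmap F (q X Y) ∘ s = q (F X) (F Y).
Proof.
destruct (act_mix_image X Y HF) as [_ [_ U]].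
destruct (U _ (p (F X) (F Y)) (q (F X) (F Y))) as [s [[H K] _]].
exists s; now rewrite H, K, act_e1_fst, act_e2_snd.
Qed.

Definition lift_app (X Y : C) : Hom (m (F X) (F Y)) (F (m X Y)) :=
  proj1_sig (constructive_indefinite_description _ (lift_str_ex X Y)).

Lemma act_fst_lift (X Y : C) : fmap F (p X Y) ∘ lift_app X Y = p (F X) (F Y).
Proof.
unfold lift_app;
  now destruct constructive_indefinite_description as [s [H K]].
Qed.

Lemma act_snd_lift (X Y : C) : fmap F (q X Y) ∘ lift_app X Y = q (F X) (F Y).
Proof.
unfold lift_app;
  now destruct constructive_indefinite_description as [s [H K]].
Qed.

Lemma lift_nat (X Y X' Y' : C) (a : Hom X X') (b : Hom Y Y') :
  lift_app X' Y' ∘ m1 (fmap F a) (fmap F b) = fmap F (m1 a b) ∘ lift_app X Y.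
Proof.
apply (is_mix_mono (act_mix_image X' Y' HF)); rewrite <- !comp_assoc, <- !fmap_comp.
- now rewrite act_fst_lift, !act_fst_nat, fmap_comp, comp_assoc, act_fst_lift.
- now rewrite act_snd_lift, !act_snd_nat, fmap_comp, comp_assoc, act_snd_lift.
Qed.

Definition lift_str : Hom (pa_act B · tf1 Mstar cell) (cell · pa_act A).
Proof.
refine (@Build_NatTrans (ProdCat C C) C' (proj1_sig (pa_act B · tf1 Mstar cell))
  (proj1_sig (cell · pa_act A)) (fun X => lift_app (pr1 X) (pr2 X)) _).
intros X Y f; exact (lift_nat (pr1 f) (pr2 f)).
Defined.

Lemma lift_iso : is_iso lift_str.
Proof.
apply nt_is_iso; intros X; exact (is_mix_compare_iso (D := alg_dec B) (act_mix _ _)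
  (act_mix_image (pr1 X) (pr2 X) HF) (act_fst_lift _ _) (act_snd_lift _ _)).
Qed.

Lemma lift_unit (X : C) : lift_app X X ∘ u (F X) = fmap F (u X).
Proof.
apply (is_mix_mono (act_mix_image X X HF)); rewrite <- !comp_assoc, <- fmap_comp.
- rewrite act_fst_lift; symmetry; apply HF.
- rewrite act_snd_lift; symmetry; apply HF.
Qed.

Lemma lift_mult (X Y Z W : C) :
  lift_app X W ∘ mu (F X) (F Y) (F Z) (F W) =
  fmap F (mu X Y Z W) ∘ (lift_app (m X Y) (m Z W) ∘ m1 (lift_app X Y) (lift_app Z W)).
Proof.
apply (is_mix_mono (act_mix_image X W HF)); rewrite <- !comp_assoc, <- fmap_comp.
- rewrite act_fst_lift, !act_fst_mult, fmap_comp, (comp_assoc (fmap F (p X Y))),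
    act_fst_lift.
  now rewrite comp_assoc, act_fst_nat, <- comp_assoc, act_fst_lift.
- rewrite act_snd_lift, !act_snd_mult, fmap_comp, (comp_assoc (fmap F (q Z W))),
    act_snd_lift.
  now rewrite comp_assoc, act_snd_nat, <- comp_assoc, act_snd_lift.
Qed.

Lemma lift_coh_unit :
  heq ((lift_str ▹ tm_eta Mstar C) ∘[slide_unit (pa_act B) cell] (pa_unit B ▹ cell))
      (cell ◃ pa_unit A).
Proof.
apply (@heq_paste_intro C C');
  [apply functor_ext; constructor | apply functor_ext; constructor | intros X].
exists eq_refl; apply heq_of_eq.
change (lift_app X X ∘ m1 (fmap F (idm X)) (fmap F (idm X)) ∘
  (idm _ ∘ (u (F X) ∘ idm (F X))) = idm _ ∘ fmap F (u X)).
now rewrite fmap_id, act_map_id, !comp_idl, !comp_idr, lift_unit.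
Qed.

Lemma lift_coh_mult :
  heq ((lift_str ▹ tm_mu Mstar C) ∘[slide_mult (pa_act B) cell]
         (pa_mult B ▹ tf1 Mstar (tf1 Mstar cell)))
      ((cell ◃ pa_mult A) ∘[tcomp1A cell (pa_act A) (tf1 Mstar (pa_act A))]
         ((lift_str ▹ tf1 Mstar (pa_act A)) ∘[split_act (pa_act B) cell (pa_act A)]
            (pa_act B ◃ tf2 Mstar lift_str))).
Proof.
apply (@heq_paste3_intro (Square (Square C)) C');
  [apply functor_ext; constructor | apply functor_ext; constructor | intros X].
exists eq_refl, eq_refl, eq_refl; apply heq_of_eq; unfold paste; simpl.
destruct X as [[X Y] [Z W]].
change (lift_app X W ∘ m1 (fmap F (idm X)) (fmap F (idm W)) ∘
   (idm _ ∘ (mu (F X) (F Y) (F Z) (F W) ∘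
     m1 (m1 (idm (F X)) (idm (F Y))) (m1 (idm (F Z)) (idm (F W))))) =
   idm _ ∘ fmap F (mu X Y Z W) ∘
   (idm _ ∘ (lift_app (m X Y) (m Z W) ∘
     m1 (fmap F (idm (m X Y))) (fmap F (idm (m Z W))) ∘
     (idm _ ∘ (idm _ ∘ m1 (lift_app X Y) (lift_app Z W)))))).
rewrite !fmap_id, !act_map_id, !comp_idl, !comp_idr; apply lift_mult.
Qed.

Definition lift : PsMorphism A B :=
  {| pm_cell := cell; pm_str := lift_str; pm_str_iso := lift_iso;
     pm_coh_mult := lift_coh_mult; pm_coh_unit := lift_coh_unit |}.

End Lift.

End Morphisms.

(** * The pseudo-algebra of a decomposition *)
Section ToAlgebra.

Context (C : PointedCat) (D : Decomposition C).
Local Notation e1 := (e1 D).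
Local Notation e2 := (e2 D).

Definition mix_ob (X Y : C) : C :=
  proj1_sig (constructive_indefinite_description _ (mix_ex D X Y)).
Definition mix_proj_sig (X Y : C) := constructive_indefinite_description _
  (proj2_sig (constructive_indefinite_description _ (mix_ex D X Y))).
Definition mix_fst (X Y : C) : Hom (mix_ob X Y) X := proj1_sig (mix_proj_sig X Y).
Definition mix_snd_sig (X Y : C) := constructive_indefinite_description _
  (proj2_sig (mix_proj_sig X Y)).
Definition mix_snd (X Y : C) : Hom (mix_ob X Y) Y := proj1_sig (mix_snd_sig X Y).

Lemma mix_ob_is_mix (X Y : C) : is_mix e1 e2 (mix_fst X Y) (mix_snd X Y).
Proof. exact (proj2_sig (mix_snd_sig X Y)). Qed.

Lemma mix_pair_ex (X Y W : C) (a : Hom W X) (b : Hom W Y) : exists g : Hom W (mix_ob X Y),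
  mix_fst X Y ∘ g = e1 X ∘ a /\ mix_snd X Y ∘ g = e2 Y ∘ b.
Proof.
destruct (mix_ob_is_mix X Y) as [_ [_ U]], (U W a b) as [g [H _]];
  now exists g.
Qed.

Definition mix_pair (X Y W : C) (a : Hom W X) (b : Hom W Y) : Hom W (mix_ob X Y) :=
  proj1_sig (constructive_indefinite_description _ (mix_pair_ex a b)).

Lemma mix_fst_pair (X Y W : C) (a : Hom W X) (b : Hom W Y) :
  mix_fst X Y ∘ mix_pair a b = e1 X ∘ a.
Proof.
unfold mix_pair;
  now destruct constructive_indefinite_description as [g [H K]].
Qed.

Lemma mix_snd_pair (X Y W : C) (a : Hom W X) (b : Hom W Y) :
  mix_snd X Y ∘ mix_pair a b = e2 Y ∘ b.
Proof.
unfold mix_pair;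
  now destruct constructive_indefinite_description as [g [H K]].
Qed.

Lemma mix_ob_mono (X Y W : C) (g h : Hom W (mix_ob X Y)) :
  mix_fst X Y ∘ g = mix_fst X Y ∘ h -> mix_snd X Y ∘ g = mix_snd X Y ∘ h -> g = h.
Proof. apply (is_mix_mono (mix_ob_is_mix X Y)). Qed.

Definition mix_map (X Y X' Y' : C) (f : Hom X X') (g : Hom Y Y') :
  Hom (mix_ob X Y) (mix_ob X' Y') :=
  mix_pair (f ∘ mix_fst X Y) (g ∘ mix_snd X Y).

Lemma mix_fst_map (X Y X' Y' : C) (f : Hom X X') (g : Hom Y Y') :
  mix_fst X' Y' ∘ mix_map f g = f ∘ mix_fst X Y.
Proof.
unfold mix_map; rewrite mix_fst_pair, <- comp_assoc, e1_nat, comp_assoc; f_equal;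
  apply mix_ob_is_mix.
Qed.

Lemma mix_snd_map (X Y X' Y' : C) (f : Hom X X') (g : Hom Y Y') :
  mix_snd X' Y' ∘ mix_map f g = g ∘ mix_snd X Y.
Proof.
unfold mix_map; rewrite mix_snd_pair, <- comp_assoc, e2_nat, comp_assoc; f_equal;
  apply mix_ob_is_mix.
Qed.

Definition mix_functor : Functor (ProdCat C C) C.
Proof.
refine (@Build_Functor (ProdCat C C) C (fun X => mix_ob (pr1 X) (pr2 X))
  (fun X Y f => mix_map (pr1 f) (pr2 f)) _ _).
- abstract (intros; apply mix_ob_mono; rewrite ?mix_fst_map, ?mix_snd_map, comp_idr;
    apply comp_idl).
- abstract (intros; apply mix_ob_mono; rewrite <- comp_assoc, ?mix_fst_map,
    ?mix_snd_map, comp_assoc,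
    ?mix_fst_map, ?mix_snd_map; apply comp_assoc).
Defined.

Lemma mix_functor_zero : preserves_zero mix_functor.
Proof.
intros [X Y] H; apply is_zero_pair in H; simpl in H; destruct H as [HX HY].
apply is_zero_idm; apply mix_ob_mono.
- destruct (proj1 HX (mix_ob X Y)) as [f Hf]; now rewrite (Hf (_ ∘ zmor)), (Hf (_ ∘ _)).
- destruct (proj1 HY (mix_ob X Y)) as [f Hf]; now rewrite (Hf (_ ∘ zmor)), (Hf (_ ∘ _)).
Qed.

Definition mix_act : @thom PointCat (Mstar C) C := exist _ mix_functor mix_functor_zero.

Definition mix_unit (X : C) : Hom X (mix_ob X X) := mix_pair (idm X) (idm X).

Lemma mix_fst_unit (X : C) : mix_fst X X ∘ mix_unit X = e1 X.
Proof. unfold mix_unit; now rewrite mix_fst_pair, comp_idr. Qed.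

Lemma mix_snd_unit (X : C) : mix_snd X X ∘ mix_unit X = e2 X.
Proof. unfold mix_unit; now rewrite mix_snd_pair, comp_idr. Qed.

Lemma mix_unit_nat (X Y : C) (f : Hom X Y) : mix_unit Y ∘ f = mix_map f f ∘ mix_unit X.
Proof.
apply mix_ob_mono; rewrite <- !comp_assoc.
- now rewrite mix_fst_map, mix_fst_unit, comp_assoc, mix_fst_unit, e1_nat.
- now rewrite mix_snd_map, mix_snd_unit, comp_assoc, mix_snd_unit, e2_nat.
Qed.

Definition mix_unit_cell : Hom (@tid PointCat C) (mix_act · tm_eta Mstar C) :=
  @Build_NatTrans C C (IdF C) (CompF mix_functor (Diag C)) mix_unit mix_unit_nat.

Lemma mix_unit_cell_iso : is_iso mix_unit_cell.
Proof.
apply nt_is_iso; intros X.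
exact (is_mix_compare_iso (mix_self D X) (mix_ob_is_mix X X) (mix_fst_unit X) (mix_snd_unit X)).
Qed.

Definition mix_mult (X Y Z W : C) : Hom (mix_ob (mix_ob X Y) (mix_ob Z W)) (mix_ob X W) :=
  mix_pair (mix_fst X Y ∘ mix_fst _ _) (mix_snd Z W ∘ mix_snd _ _).

Lemma mix_fst_mult (X Y Z W : C) :
  mix_fst X W ∘ mix_mult X Y Z W = mix_fst X Y ∘ mix_fst (mix_ob X Y) (mix_ob Z W).
Proof.
unfold mix_mult; rewrite mix_fst_pair, <- comp_assoc; f_equal;
  apply mix_ob_is_mix.
Qed.

Lemma mix_snd_mult (X Y Z W : C) :
  mix_snd X W ∘ mix_mult X Y Z W = mix_snd Z W ∘ mix_snd (mix_ob X Y) (mix_ob Z W).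
Proof.
unfold mix_mult; rewrite mix_snd_pair, <- comp_assoc; f_equal;
  apply mix_ob_is_mix.
Qed.

Lemma mix_mult_nat (X Y Z W X' Y' Z' W' : C) (a : Hom X X') (b : Hom Y Y') (c : Hom Z Z')
  (d : Hom W W') : mix_mult X' Y' Z' W' ∘ mix_map (mix_map a b) (mix_map c d) =
    mix_map a d ∘ mix_mult X Y Z W.
Proof.
apply mix_ob_mono; rewrite <- !comp_assoc.
- now rewrite mix_fst_mult, (mix_fst_map a d), !comp_assoc, mix_fst_mult, mix_fst_map,
    <- !comp_assoc, mix_fst_map.
- now rewrite mix_snd_mult, (mix_snd_map a d), !comp_assoc, mix_snd_mult, mix_snd_map,
    <- !comp_assoc, mix_snd_map.
Qed.

Definition mix_mult_cell : Hom (mix_act · tf1 Mstar mix_act) (mix_act · tm_mu Mstar C).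
Proof.
refine (@Build_NatTrans (ProdCat (ProdCat C C) (ProdCat C C)) C
  (CompF mix_functor (SquareFun mix_functor)) (CompF mix_functor (Proj14 C))
  (fun X => mix_mult (pr1 (pr1 X)) (pr2 (pr1 X)) (pr1 (pr2 X)) (pr2 (pr2 X))) _).
intros X Y f; exact (mix_mult_nat _ _ _ _).
Defined.

Lemma mix_mult_cell_iso : is_iso mix_mult_cell.
Proof.
apply nt_is_iso; intros X;
  refine (is_mix_compare_iso _ (mix_ob_is_mix _ _) (mix_fst_mult _ _ _ _) (mix_snd_mult _ _ _ _)).
exact (is_mix_comp (mix_ob_is_mix _ _) (mix_ob_is_mix _ _) (mix_ob_is_mix _ _)).
Qed.

Lemma mix_map_id (X Y : C) : mix_map (idm X) (idm Y) = idm (mix_ob X Y).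
Proof. exact (fmap_id mix_functor ⟨X, Y⟩). Qed.

Lemma mix_mult_unit (X Y : C) :
  mix_mult X Y X Y ∘ mix_unit (mix_ob X Y) = idm (mix_ob X Y).
Proof.
apply mix_ob_mono; rewrite <- comp_assoc, comp_idr.
- rewrite mix_fst_mult, comp_assoc, mix_fst_unit, <- e1_nat; apply mix_ob_is_mix.
- rewrite mix_snd_mult, comp_assoc, mix_snd_unit, <- e2_nat; apply mix_ob_is_mix.
Qed.

Lemma mix_mult_map_unit (X Y : C) :
  mix_mult X X Y Y ∘ mix_map (mix_unit X) (mix_unit Y) = idm (mix_ob X Y).
Proof.
apply mix_ob_mono; rewrite <- comp_assoc, comp_idr.
- rewrite mix_fst_mult, comp_assoc, mix_fst_map, <- comp_assoc, mix_fst_unit;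
    apply mix_ob_is_mix.
- rewrite mix_snd_mult, comp_assoc, mix_snd_map, <- comp_assoc, mix_snd_unit;
    apply mix_ob_is_mix.
Qed.

Lemma mix_mult_mult (X1 X2 X3 X4 Y1 Y2 Y3 Y4 : C) :
  mix_mult X1 X2 Y3 Y4 ∘
    mix_mult (mix_ob X1 X2) (mix_ob X3 X4) (mix_ob Y1 Y2) (mix_ob Y3 Y4) =
  mix_mult X1 X4 Y1 Y4 ∘ mix_map (mix_mult X1 X2 X3 X4) (mix_mult Y1 Y2 Y3 Y4).
Proof.
apply mix_ob_mono; rewrite <- !comp_assoc.
- now rewrite !mix_fst_mult, !comp_assoc, mix_fst_mult, mix_fst_map, <- !comp_assoc,
    mix_fst_mult.
- now rewrite !mix_snd_mult, !comp_assoc, mix_snd_mult, mix_snd_map, <- !comp_assoc,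
    mix_snd_mult.
Qed.

Lemma mix_coh_unitl :
  heq ((mix_mult_cell ▹ tm_eta Mstar (Mstar C)) ∘[slide_unit mix_act mix_act]
         (mix_unit_cell ▹ mix_act))
      (idm mix_act).
Proof.
apply (@heq_paste_intro (Square C) C);
  [apply functor_ext; constructor | apply functor_ext; constructor | intros [X Y]].
exists eq_refl; apply heq_of_eq; unfold paste; simpl.
now rewrite !mix_map_id, !comp_idl, !comp_idr, mix_mult_unit.
Qed.

Lemma mix_coh_unitr :
  heq ((mix_mult_cell ▹ tf1 Mstar (tm_eta Mstar C))
         ∘[split_act mix_act mix_act (tm_eta Mstar C)]
         (mix_act ◃ tf2 Mstar mix_unit_cell))
      (idm mix_act).
Proof.
apply (@heq_paste_intro (Square C) C);
  [apply functor_ext; constructor | apply functor_ext; constructor | intros [X Y]].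
exists eq_refl; apply heq_of_eq; unfold paste; simpl.
now rewrite !mix_map_id, !comp_idl, !comp_idr, mix_mult_map_unit.
Qed.

Lemma mix_coh_mult :
  heq ((mix_mult_cell ▹ tm_mu Mstar (Mstar C)) ∘[slide_mult mix_act mix_act]
         (mix_mult_cell ▹ tf1 Mstar (tf1 Mstar mix_act)))
      ((mix_mult_cell ▹ tf1 Mstar (tm_mu Mstar C))
         ∘[split_act mix_act mix_act (tm_mu Mstar C)]
         (mix_act ◃ tf2 Mstar mix_mult_cell)).
Proof.
apply (@heq_paste2_intro (Square (Square (Square C))) C);
  [apply functor_ext; constructor | apply functor_ext; constructor|].
intros [[[X1 X2] [X3 X4]] [[Y1 Y2] [Y3 Y4]]].
exists eq_refl, eq_refl; apply heq_of_eq; unfold paste; simpl.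
rewrite !mix_map_id, !comp_idl, !comp_idr; apply mix_mult_mult.
Qed.

Definition dec_alg : PsAlgebra Mstar :=
  {| pa_unit_iso := mix_unit_cell_iso; pa_mult_iso := mix_mult_cell_iso;
    pa_coh_mult := mix_coh_mult;
    pa_coh_unitl := mix_coh_unitl; pa_coh_unitr := mix_coh_unitr |}.

(** Collapsing the second component of [mix_unit X] to zero amounts to composing with
    [e1 X] first, so the conjugate of that collapse by the unit is [e1 X]. *)
Lemma dec_algK : respects D (alg_dec dec_alg) (IdF C).
Proof.
assert (H : forall X, unit_inv (A := dec_alg) X ∘ mix_unit X = idm X)
  by exact (@unit_inv_unit dec_alg).
assert (L : forall X, mix_map (idm X) zmor ∘ mix_unit X = mix_unit X ∘ e1 X).
{ intros X; apply mix_ob_mono; rewrite <- !comp_assoc.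
  - now rewrite mix_fst_map, comp_idl, mix_fst_unit, e1_e1.
  - now rewrite mix_snd_map, mix_snd_unit, !zmorl, e2_e1. }
assert (R : forall X, mix_map zmor (idm X) ∘ mix_unit X = mix_unit X ∘ e2 X).
{ intros X; apply mix_ob_mono; rewrite <- !comp_assoc.
  - now rewrite mix_fst_map, mix_fst_unit, !zmorl, e1_e2.
  - now rewrite mix_snd_map, comp_idl, mix_snd_unit, e2_e2. }
intros X; split; symmetry.
- change (unit_inv (A := dec_alg) X ∘ mix_map (idm X) zmor ∘ mix_unit X = e1 X).
  now rewrite comp_assoc, L, <- comp_assoc, H, comp_idl.
- change (unit_inv (A := dec_alg) X ∘ mix_map zmor (idm X) ∘ mix_unit X = e2 X).
  now rewrite comp_assoc, R, <- comp_assoc, H, comp_idl.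
Qed.

End ToAlgebra.

(** * The 2-equivalence *)

Lemma respects_sym (C : PointedCat) (D D' : Decomposition C) :
  respects D D' (IdF C) -> respects D' D (IdF C).
Proof. intros H X; destruct (H X); now split; symmetry. Qed.

Lemma respects_conj (C C' : PointedCat) (D1 D2 : Decomposition C)
  (D1' D2' : Decomposition C') (F : Functor C C') :
  respects D1 D2 (IdF C) -> respects D1' D2' (IdF C') ->
  respects D1 D1' F -> respects D2 D2' F.
Proof.
intros H H' HF X; destruct (H X) as [H1 H2], (H' (F X)) as [H1' H2']; simpl in *.
rewrite <- H1, <- H2, <- H1', <- H2'; apply HF.
Qed.

(** 2-functors that agree on objects by computation, so that no transport is needed. *)
Lemma two_functor_ext (K L : TwoCategory) (o : K -> L)
  (h h' : forall A B, Functor (@thom K A B) (@thom L (o A) (o B)))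
  (i : forall A, h A A (tid A) = tid (o A)) (i' : forall A, h' A A (tid A) = tid (o A))
  (c : forall A B C (g : thom B C) (f : thom A B), h A C (g · f) = h B C g · h A B f)
  (c' : forall A B C (g : thom B C) (f : thom A B), h' A C (g · f) = h' B C g · h' A B f)
  (c2 : forall A B C (g g' : thom B C) (f f' : thom A B) (β : Hom g g') (α : Hom f f'),
    heq (fmap (h A C) (β ⋆ α)) (fmap (h B C) β ⋆ fmap (h A B) α))
  (c2' : forall A B C (g g' : thom B C) (f f' : thom A B) (β : Hom g g') (α : Hom f f'),
    heq (fmap (h' A C) (β ⋆ α)) (fmap (h' B C) β ⋆ fmap (h' A B) α)) :
  (forall A B (f g : thom A B) (α : Hom f g), heq (fmap (h A B) α) (fmap (h' A B) α)) ->
  @Build_TwoFunctor K L o h i c c2 = @Build_TwoFunctor K L o h' i' c' c2'.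
Proof.
intros E; assert (Eh : h = h').
{ apply functional_extensionality_dep; intros A.
  apply functional_extensionality_dep; intros B; apply functor_ext, E. }
destruct Eh; f_equal; apply proof_irrelevance.
Qed.

Definition alg_of (C : TorR) : PsAlg Mstar := dec_alg (torsion_dec C).

Definition tor_of (A : PsAlg Mstar) : TorR := dec_torsion (alg_dec A).

Lemma alg_of_respects (C C' : TorR) (F : @thom TorR C C') :
  respects (alg_dec (alg_of C)) (alg_dec (alg_of C')) (proj1_sig F).
Proof.
exact (respects_conj (dec_algK (torsion_dec C)) (dec_algK (torsion_dec C'))
  (torsion_functor_respects (proj2_sig F))).
Qed.

Definition alg_of1 (C C' : TorR) (F : @thom TorR C C') :
  @thom (PsAlg Mstar) (alg_of C) (alg_of C') :=
  @lift (alg_of C) (alg_of C') (proj1_sig F)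
    (torsion_functor_zero (proj2_sig F)) (alg_of_respects F).

Definition alg_of2 (C C' : TorR) (F G : @thom TorR C C') (σ : Hom F G) :
  Hom (alg_of1 F) (alg_of1 G) :=
  @Build_AlgCell _ _ _ _ (alg_of1 F) (alg_of1 G) σ
    (is_alg_cell_of_nt (f := alg_of1 F) (g := alg_of1 G) σ).

Definition alg_of_hom (C C' : TorR) :
  Functor (@thom TorR C C') (@thom (PsAlg Mstar) (alg_of C) (alg_of C')).
Proof.
refine (@Build_Functor (@thom TorR C C') (@thom (PsAlg Mstar) (alg_of C) (alg_of C'))
  (@alg_of1 C C') (@alg_of2 C C') _ _);
  abstract (intros; apply alg_cell_ext; reflexivity).
Defined.

Definition AlgOf : TwoFunctor TorR (PsAlg Mstar).
Proof.
refine (@Build_TwoFunctor TorR (PsAlg Mstar) alg_of alg_of_hom _ _ _).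
- abstract (intros; apply psmor_unique, full_eq; reflexivity).
- abstract (intros; apply psmor_unique, full_eq; reflexivity).
- abstract (intros; apply heq_algcat; [apply psmor_unique, full_eq; reflexivity
    | apply psmor_unique, full_eq; reflexivity
    | apply heq_nt; [reflexivity | reflexivity | intros; constructor]]).
Defined.

Lemma tor_of_torsion (A B : PsAlg Mstar) (f : thom A B) :
  @torsion_functor (tor_of A) (tor_of B) (psmor_functor f).
Proof.
apply respects_torsion_functor.
exact (respects_conj (dec_torsionK (alg_dec A)) (dec_torsionK (alg_dec B))
  (psmor_respects f)).
Qed.

Definition tor_of_hom (A B : PsAlg Mstar) :
  Functor (thom A B) (@thom TorR (tor_of A) (tor_of B)).
Proof.
refine (@Build_Functor (thom A B) (@thom TorR (tor_of A) (tor_of B))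
  (fun f => exist _ (psmor_functor f) (tor_of_torsion f)) (fun f g σ => ac_cell σ) _ _);
  abstract reflexivity.
Defined.

Definition TorOf : TwoFunctor (PsAlg Mstar) TorR.
Proof.
refine (@Build_TwoFunctor (PsAlg Mstar) TorR tor_of tor_of_hom _ _ _).
- abstract (intros; apply full_eq; reflexivity).
- abstract (intros; apply full_eq; reflexivity).
- abstract (intros; apply heq_nt; [reflexivity | reflexivity | intros; constructor]).
Defined.

Lemma forget_AlgOf : CompTF (PsAlgForget Mstar) AlgOf = TorRForget.
Proof.
apply two_functor_ext; intros C C' F G α.
apply heq_nt; [reflexivity | reflexivity | intros; constructor].
Qed.

Lemma forget_TorOf : CompTF TorRForget TorOf = PsAlgForget Mstar.
Proof.
apply two_functor_ext; intros A B f g α.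
apply heq_nt; [reflexivity | reflexivity | intros; constructor].
Qed.

Lemma respects_trans (C : PointedCat) (D D' D'' : Decomposition C) :
  respects D D' (IdF C) -> respects D' D'' (IdF C) -> respects D D'' (IdF C).
Proof. intros H H' X; destruct (H X), (H' X); simpl in *; split; congruence. Qed.

(** Both round trips leave the idempotents unchanged, so identity functors are 1-cells
    in both directions; these are the components of the unit and the counit. *)
Lemma tor_alg_respects (C : TorR) :
  respects (torsion_dec C) (torsion_dec (tor_of (alg_of C))) (IdF (rt_pointedcat C)).
Proof.
exact (respects_trans (dec_algK (torsion_dec C)) (dec_torsionK (alg_dec (alg_of C)))).
Qed.

Lemma alg_tor_respects (A : PsAlg Mstar) :
  respects (alg_dec A) (alg_dec (alg_of (tor_of A))) (IdF (pa_car A)).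
Proof.
exact (respects_trans (dec_torsionK (alg_dec A)) (dec_algK (torsion_dec (tor_of A)))).
Qed.

Lemma preserves_zero_id (C : PointedCat) : preserves_zero (IdF C).
Proof. intros Z H; exact H. Qed.

Definition tor_unit (C : TorR) : @thom TorR C (tor_of (alg_of C)) :=
  exist _ (IdF C) (respects_torsion_functor (C' := tor_of (alg_of C)) (@tor_alg_respects C)).

Definition tor_unit_inv (C : TorR) : @thom TorR (tor_of (alg_of C)) C :=
  exist _ (IdF C)
    (respects_torsion_functor (C := tor_of (alg_of C)) (respects_sym (@tor_alg_respects C))).

Definition TorUnit : TwoNat (IdTF TorR) (CompTF TorOf AlgOf).
Proof.
refine (@Build_TwoNat TorR TorR (IdTF TorR) (CompTF TorOf AlgOf) tor_unit _ _).
- abstract (intros; apply full_eq, functor_ext; constructor).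
- abstract (intros; apply heq_nt; [apply functor_ext; constructor
    | apply functor_ext; constructor
    | intros; simpl; rewrite fmap_id, comp_idl, comp_idr; constructor]).
Defined.

Definition alg_counit (A : PsAlg Mstar) : @thom (PsAlg Mstar) (alg_of (tor_of A)) A :=
  @lift (alg_of (tor_of A)) A (IdF (pa_car A)) (@preserves_zero_id (pa_car A))
    (respects_sym (@alg_tor_respects A)).

Definition alg_counit_inv (A : PsAlg Mstar) : @thom (PsAlg Mstar) A (alg_of (tor_of A)) :=
  @lift A (alg_of (tor_of A)) (IdF (pa_car A)) (@preserves_zero_id (pa_car A))
    (@alg_tor_respects A).

Definition AlgCounit : TwoNat (CompTF AlgOf TorOf) (IdTF (PsAlg Mstar)).
Proof.
refine (@Build_TwoNat _ _ (CompTF AlgOf TorOf) (IdTF (PsAlg Mstar)) alg_counit _ _).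
- abstract (intros; apply psmor_unique, full_eq, functor_ext; constructor).
- abstract (intros; apply heq_algcat;
    [apply psmor_unique, full_eq, functor_ext; constructor
    |apply psmor_unique, full_eq, functor_ext; constructor
    |apply heq_nt; [apply functor_ext; constructor | apply functor_ext; constructor
       |intros; simpl; rewrite fmap_id, comp_idl, comp_idr; constructor]]).
Defined.

Lemma existT_congr (I : Type) (T : I -> Type) (i : I) (x y : T i) :
  x = y -> existT T i x = existT T i y.
Proof. now intros ->. Qed.

Theorem theorem3p12 : two_equivalent_over TorRForget (PsAlgForget Mstar).
Proof.
exists AlgOf, TorOf; split; [exact forget_AlgOf | split; [exact forget_TorOf | split]].
- exists TorUnit; split.
  + intros C; exists (tor_unit_inv C); split; apply full_eq, functor_ext; constructor.
  + intros C; apply (existT_congr (T := fun B => Ob (@thom PointCat (rt_pointedcat C) B))).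
    apply full_eq; reflexivity.
- exists AlgCounit; split.
  + intros A; exists (alg_counit_inv A); split; apply psmor_unique, full_eq, functor_ext;
      constructor.
  + intros A; apply (existT_congr (T := fun B => Ob (@thom PointCat (pa_car A) B))).
    apply full_eq; reflexivity.
Qed.
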